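(* Let $A\in\mathbb{R}_{\max}^{d\times d}$ with $\lambda(A)=0$ have factor rank $r$, and fix a factorization $A=U\otimes L$ with $U\in\mathbb{R}_{\max}^{d\times r}$, $L\in\mathbb{R}_{\max}^{r\times d}$; put $\check A=L\otimes U$. Let $\mathcal{G}$ be a strongly connected subgraph of $\mathcal{G}^c(A)$ (containing at least one arc) whose related subgraph $\check{\mathcal{G}}$ in $\mathcal{G}(\check A)$ has $|\check{\mathcal{G}}|$ nodes and circumference $\mathrm{cr}(\check{\mathcal{G}})$. Then: (i) $T_{wr}^{l}(A,\mathcal{G})\le 1+r(l+1)-|\check{\mathcal{G}}|$ for any positive integer $l$; (ii) if $A$ is irreducible with cyclicity $\gamma$ and $l$ is a positive multiple of $\gamma$, then $T_{wr}^{l}(A,\mathcal{G})\le l\left\lfloor\frac{r}{\gamma}\right\rfloor+r-\mathrm{cr}(\check{\mathcal{G}})+\gamma$; (iii) if the factor rank $r$ is equal to the max-girth of $\mathcal{G}^c(A)$ and $Z$ is a critical cycle with length $r$, then $T_{wr}^{r}(A,Z)\le \mathrm{Wi}(r)+r+1$; (iv) if $A$ is irreducible with cyclicity $\gamma$, $\gamma\left\lfloor\frac{r}{\gamma}\right\rfloor$ is the max-girth of $\mathcal{G}^c(A)$, and $Z$ is a critical cycle with length $\gamma\left\lfloor\frac{r}{\gamma}\right\rfloor$ that attains the max-girth in a strongly connected component of $\mathcal{G}^c(A)$, then $T_{wr}^{\gamma\lfloor r/\gamma\rfloor}(A,Z)\le \gamma\,\mathrm{Wi}\left(\left\lfloo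r\frac{r}{\gamma}\right\rfloor\right)+r+\gamma$.
   Context: Max-plus algebra: $\mathbb{R}_{\max}=\mathbb{R}\cup\{-\infty\}$ with $a\oplus b=\max(a,b)$, $a\otimes b=a+b$; matrix product $(A\otimes B)_{ij}=\max_k(a_{ik}+b_{kj})$. The (tropical) factor rank of $A\in\mathbb{R}_{\max}^{n\times m}$ is the smallest $r\in\mathbb{N}$ such that $A=U\otimes L$ with $U\in\mathbb{R}_{\max}^{n\times r}$, $L\in\mathbb{R}_{\max}^{r\times m}$. Graphs: $\mathcal{G}(A)$ is the weighted digraph with nodes $1,\dots,d$ and an arc $(i,j)$ of weight $a_{ij}$ whenever $a_{ij}\ne-\infty$. The length $l(W)$ of a walk $W$ is its number of arcs, its weight $p(W)$ is the sum of its arc weights. A cycle is a closed walk with at least one arc and no repeated node other than its coinciding ends (also regarded as a subgraph). $A$ is irreducible if $\mathcal{G}(A)$ is strongly connected. $\lambda(A)$ is the maximum over cycles of weight divided by length; cycles attaining it are critical, and $\mathcal{G}^c(A)$ consists of all nodes and arcs of critical cycles. A digraph is completely reducible if it is a disjoint union of strongly connected components with no arcs between them. The girth of a strongly connected digraph is the smallest length of a cycle, and its circumference is the largest length of a cycle; the max-girth of a completely reducible digraph is the greatest girth of its components. The cyclicity of a strongly connected digraph is the gcd of its cycle lengths; the cyclicity of an irreducible $A$ is that of $\mathcal{G}(A)$. Lifts and related subgraphs: let $F=\begin{pmatrix}-\infty&U\\ L&-\infty\end{pmatrix}$ (square of size $d+r$), whose first $d$ nodes are identified with the nodes of $\mathcal{G}(A)$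 and last $r$ nodes with those of $\mathcal{G}(\check A)$. A lift of a walk $W=i_1\ldots i_m$ on $\mathcal{G}(A)$ or $\mathcal{G}(\check A)$ is a walk $\tilde W=i_1j_1i_2\ldots j_{m-1}i_m$ on $\mathcal{G}(F)$ with $p(\tilde W)=p(W)$. For a closed walk $W=i_1\ldots i_m$ ($i_1=i_m$) on $\mathcal{G}(A)$ (resp. $\mathcal{G}(\check A)$), a closed walk $V=j_1\ldots j_m$ ($j_1=j_m$) on $\mathcal{G}(\check A)$ (resp. $\mathcal{G}(A)$) is related to $W$ if $p(W)=p(V)$ and $i_1j_1\ldots j_{m-1}i_m$ is a lift of $W$. For a completely reducible subgraph $\mathcal{G}$ of $\mathcal{G}(A)$, the related subgraph $\check{\mathcal{G}}$ of $\mathcal{G}(\check A)$ consists of all nodes and arcs of all closed walks related to closed walks of $\mathcal{G}$. Walk reduction threshold: for a subgraph $\mathcal{G}$ of $\mathcal{G}(A)$ and a positive integer $\sigma$, $T_{wr}^{\sigma}(A,\mathcal{G})$ is the smallest nonnegative integer $T$ such that: for all nodes $i,j$ and each walk $W$ on $\mathcal{G}(A)$ from $i$ to $j$ that goes through a node of $\mathcal{G}$ and has length $\ge T$, there is a walk $V$ from $i$ to $j$ going through a node of $\mathcal{G}$ with $p(V)\ge p(W)$, $l(V)\equiv l(W)\pmod\sigma$ and $l(V)\le T$. $\mathrm{Wi}(n)=(n-1)^2+1$ if $n>1$ and $\mathrm{Wi}(1)=0$. *)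

(* Defs.v *)
From mathcomp Require Import all_boot all_order all_algebra.
From mathcomp Require Import boolp reals constructive_ereal.

Set Implicit Arguments.
Unset Strict Implicit.
Unset Printing Implicit Defensive.

Import Order.TTheory GRing.Theory Num.Theory.

Local Open Scope nat_scope.

Section Digraphs.
Variable T : finType.

(* A walk is the non-empty sequence of its nodes; it has one arc less than it
   has entries. *)
Definition wlen (W : seq T) : nat := (size W).-1.

Definition warcs (W : seq T) : seq (T * T) := zip W (behead W).

Definition is_closed (W : seq T) : bool :=
  if W is x :: p then last x p == x else false.

Record digraph := Digraph {
  nodes : {set T};
  arcs : {set T * T};
  arcs_nodes : forall i j, (i, j) \in arcs -> (i \in nodes) && (j \in nodes) }.

Definition is_walk (G : digraph) (W : seq T) : bool :=
  if W is x :: p then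
    (x \in nodes G) && path [rel y z | (y, z) \in arcs G] x p
  else false.

Definition walk_between (G : digraph) (i j : T) (W : seq T) : bool :=
  is_walk G W && (if W is x :: p then (x == i) && (last x p == j) else false).

(* A cycle is listed as i_1 ... i_m with i_m = i_1, hence [uniq] of the tail. *)
Definition is_cycle (G : digraph) (W : seq T) : bool :=
  [&& is_walk G W, 0 < wlen W, is_closed W & uniq (behead W)].

Definition through (G : digraph) (W : seq T) : bool :=
  has (fun x => x \in nodes G) W.

Definition subgraph (H G : digraph) : bool :=
  (nodes H \subset nodes G) && (arcs H \subset arcs G).

Definition reach (G : digraph) (i j : T) : Prop :=
  exists W, walk_between G i j W.

Definition strongly_connected (G : digraph) : Prop :=
  forall i j, i \in nodes G -> j \in nodes G -> reach G i j.

Lemma warcs_mem (W : seq T) (i j : T) :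
  (i, j) \in warcs W -> (i \in W) && (j \in W).
Proof.
have zip_mem (s t : seq T) : (i, j) \in zip s t -> (i \in s) && (j \in t).
  elim: s t => [|x s IH] [|y t] //=; rewrite !inE xpair_eqE.
  by case/orP => [/andP[-> ->] // | /IH/andP[-> ->]]; rewrite !orbT.
by case: W => [//|x p] /zip_mem /= /andP[-> jp]; rewrite inE jp orbT.
Qed.

Fact span_arcs_nodes (P : seq T -> Prop) i j :
  (i, j) \in [set a | `[< exists2 W, P W & a \in warcs W >]] ->
  (i \in [set x | `[< exists2 W, P W & x \in W >]]) &&
  (j \in [set x | `[< exists2 W, P W & x \in W >]]).
Proof.
rewrite !inE => /asboolP[W PW /warcs_mem/andP[iW jW]].
by apply/andP; split; apply/asboolP; exists W.
Qed.

(* All nodes and arcs of the walks in the family P. *)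
Definition span (P : seq T -> Prop) : digraph :=
  Digraph (@span_arcs_nodes P).

Definition graph_of_walk (Z : seq T) : digraph := span (fun W => W = Z).

Fact component_arcs_nodes (G : digraph) (x : T) i j :
  let N := [set y | `[< reach G x y >] && `[< reach G y x >]] in
  (i, j) \in [set a in arcs G | (a.1 \in N) && (a.2 \in N)] ->
  (i \in N) && (j \in N).
Proof. by move=> N; rewrite inE => /andP[]. Qed.

(* The strongly connected component of the node x (empty if x is not a node
   of G). *)
Definition component (G : digraph) (x : T) : digraph :=
  Digraph (@component_arcs_nodes G x).

(* A cycle visits each node at most once, so its length is at most #|T|. *)
Definition cycle_lengths (G : digraph) : {set 'I_#|T|.+1} :=
  [set k : 'I_#|T|.+1 | `[< exists2 c, is_cycle G c & wlen c = k >]].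

(* The value #|T|.+1 is only reached when G has no cycle. *)
Definition girth (G : digraph) : nat :=
  \big[minn/#|T|.+1]_(k in cycle_lengths G) k.

Definition circumference (G : digraph) : nat :=
  \max_(k in cycle_lengths G) k.

Definition cyclicity (G : digraph) : nat :=
  \big[gcdn/0]_(k in cycle_lengths G) k.

Definition max_girth (G : digraph) : nat :=
  \max_(x in nodes G) girth (component G x).

End Digraphs.

(* interleave [:: i_1; ...; i_m] [:: j_1; ...; j_(m-1)]
   = [:: i_1; j_1; i_2; ...; j_(m-1); i_m] *)
Fixpoint interleave (T : Type) (s t : seq T) : seq T :=
  match s, t with
  | x :: s', y :: t' => x :: y :: interleave s' t'
  | _, _ => s
  end.

Definition Wi (n : nat) : nat := if 1 < n then (n - 1) ^ 2 + 1 else 0.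

Section MaxPlus.
Variable R : realType.
Local Open Scope ereal_scope.

(* R_max is the set of extended reals other than +oo. *)
Definition in_Rmax (n m : nat) (A : 'M[\bar R]_(n, m)) : Prop :=
  forall i j, A i j != +oo.

Definition maxplus_mul (n k m : nat)
    (A : 'M[\bar R]_(n, k)) (B : 'M[\bar R]_(k, m)) : 'M[\bar R]_(n, m) :=
  \matrix_(i, j) \big[maxe/-oo]_(l < k) (A i l + B l j).

Definition factorizable (n m : nat) (A : 'M[\bar R]_(n, m)) (r : nat) : Prop :=
  exists (U : 'M[\bar R]_(n, r)) (L : 'M[\bar R]_(r, m)),
    [/\ in_Rmax U, in_Rmax L & A = maxplus_mul U L].

Definition is_factor_rank (n m : nat) (A : 'M[\bar R]_(n, m)) (r : nat) : Prop :=
  factorizable A r /\ forall k, factorizable A k -> (r <= k)%N.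

Fact mxgraph_arcs_nodes (d : nat) (A : 'M[\bar R]_d) i j :
  (i, j) \in [set a | A a.1 a.2 != -oo] ->
  (i \in [set: 'I_d]) && (j \in [set: 'I_d]).
Proof. by rewrite !inE. Qed.

Definition mxgraph (d : nat) (A : 'M[\bar R]_d) : digraph 'I_d :=
  Digraph (@mxgraph_arcs_nodes d A).

Definition weight (d : nat) (A : 'M[\bar R]_d) (W : seq 'I_d) : \bar R :=
  \sum_(a <- warcs W) A a.1 a.2.

Definition irreducible (d : nat) (A : 'M[\bar R]_d) : Prop :=
  strongly_connected (mxgraph A).

Definition cycle_mean (d : nat) (A : 'M[\bar R]_d) (c : seq 'I_d) : \bar R :=
  weight A c * ((wlen c)%:R^-1)%:E.

(* A cycle with k+1 arcs is a sequence of k+2 nodes, and k+1 <= d. *)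
Definition lambda (d : nat) (A : 'M[\bar R]_d) : \bar R :=
  \big[maxe/-oo]_(k < d)
    \big[maxe/-oo]_(c : k.+2.-tuple 'I_d | is_cycle (mxgraph A) c)
      cycle_mean A c.

Definition is_critical (d : nat) (A : 'M[\bar R]_d) (c : seq 'I_d) : Prop :=
  is_cycle (mxgraph A) c /\ cycle_mean A c = lambda A.

Definition critical_graph (d : nat) (A : 'M[\bar R]_d) : digraph 'I_d :=
  span (is_critical A).

Section Lifts.
Variables (d r : nat) (U : 'M[\bar R]_(d, r)) (L : 'M[\bar R]_(r, d)).

Definition lift_mx : 'M[\bar R]_(d + r) :=
  block_mx (const_mx -oo) U L (const_mx -oo).

Definition is_lift (W : seq 'I_d) (W' : seq 'I_(d + r)) : Prop :=
  [/\ is_walk (mxgraph (maxplus_mul U L)) W,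
      is_walk (mxgraph lift_mx) W',
      (exists2 J : seq 'I_r, size J = wlen W &
         W' = interleave (map (@lshift d r) W) (map (@rshift d r) J)) &
      weight lift_mx W' = weight (maxplus_mul U L) W].

(* Walks without arcs are excluded: a one-node walk lifts to itself, and every
   node j_1 would otherwise be related to it. *)
Definition related (W : seq 'I_d) (V : seq 'I_r) : Prop :=
  [/\ is_walk (mxgraph (maxplus_mul U L)) W && is_closed W,
      is_walk (mxgraph (maxplus_mul L U)) V && is_closed V,
      (0 < wlen W)%N && (size V == size W),
      weight (maxplus_mul U L) W = weight (maxplus_mul L U) V &
      is_lift W (interleave (map (@lshift d r) W)
                            (map (@rshift d r) (take (wlen V) V)))].

Definition related_graph (G : digraph 'I_d) : digraph 'I_r :=
  span (fun V => exists2 W, is_walk G W & related W V).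

End Lifts.

Definition walk_reducing (d : nat) (A : 'M[\bar R]_d) (G : digraph 'I_d)
    (sigma T : nat) : Prop :=
  forall (i j : 'I_d) (W : seq 'I_d),
    walk_between (mxgraph A) i j W -> through G W -> (T <= wlen W)%N ->
    exists V : seq 'I_d,
      [/\ walk_between (mxgraph A) i j V, through G V,
          weight A W <= weight A V,
          (wlen V = wlen W %[mod sigma])%N & (wlen V <= T)%N].

Definition is_Twr (d : nat) (A : 'M[\bar R]_d) (G : digraph 'I_d)
    (sigma T : nat) : Prop :=
  walk_reducing A G sigma T /\
  forall T', walk_reducing A G sigma T' -> (T <= T')%N.

End MaxPlus.

(* Main.v *)
Require Import Defs.
From mathcomp Require Import all_boot all_order all_algebra.
From mathcomp Require Import boolp reals constructive_ereal.
From mathcomp Require Import zify lra.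

Set Implicit Arguments.
Unset Strict Implicit.
Unset Printing Implicit Defensive.

Import Order.TTheory GRing.Theory Num.Theory.

Local Open Scope nat_scope.

(* A walk on [A = U L] lifts to a walk on [C = L U], up to one arc at each end,
   and back, so walks can be reduced on the [r] nodes of [C]. If [x k y k' z]
   lifts two arcs [(x, y)], [(y, z)] of [G], then [y] is an optimal middle node of
   the arc [(k, k')] of [C]: a walk using such an arc comes back to a walk through
   a node of [G].

   (i), (ii): in a shortest walk touching a lifted node, a node visited twice at
   congruent times yields a removable closed walk; hence at most [l / gamma]
   visits to each lifted node and [l / gamma + 1] to the others. Splicing in a
   nonempty walk made of lifted arcs, of least total length, costs one more visit
   to a single lifted node. Then one counts the visits to all nodes, or to one
   cyclic class.

   (iii), (iv): the critical cycle lifts to a cycle through all nodes of a cyclic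
   class with [m = r / gamma] nodes. The walk of [gamma]-steps on this class is cut
   into a path and loops; all but at most [m - 1] loops, of length at most
   [m - 1], are dropped by a zero-sum argument modulo [m], and the others are
   reattached, through the Hamiltonian cycle when there is room for it. *)

(** * Weighted walks *)

(** Visiting a lifted node is not enough. Passing back to [A] opens each arc of [C] at an optimal
    middle node, and for the arcs of [C] around a lifted node these may all lie outside [G]. So each
    reduction on [C] must end with a walk containing a whole lifted arc; this costs the extra visit
    in (i), (ii) and the exchange of a piece of the walk at the end of (iii), (iv). Weight is never
    lost: closed walks on [C] have weight at most 0, and a walk made of lifted arcs is heaviest
    among all walks with the same ends, whatever their lengths. Minimality of [r] ensures that every
    index of the factorization is met by finite entries on both sides, so that cyclic classes pass
    from [A] to [C]. Parts (i) and (iii) are the case of a single class. *)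

Ltac lia_arith :=
  repeat match goal with
  | H : ?P |- _ =>
    lazymatch type of P with Prop =>
      lazymatch P with
      | context [modn] => clear H
      | context [divn] => clear H
      | context [dvdn] => clear H
      | is_true (leq _ _) => fail
      | @eq nat _ _ => fail
      | _ => clear H
      end
    end
  end; lia.

Lemma exists_minimal (X : Type) (P : X -> Prop) (f : X -> nat) :
  (exists x, P x) -> exists2 x, P x & forall y, P y -> f x <= f y.
Proof.
move=> exP; have exn : exists n, `[< exists2 x, P x & f x = n >].
  by case: exP => x Px; exists (f x); apply/asboolP; exists x.
case: (ex_minnP exn) => n /asboolP[x Px <-] min_x.
by exists x => // y Py; apply: min_x; apply/asboolP; exists y.
Qed.

Lemma pigeonhole (n : nat) (f : nat -> nat) :
  (forall i, i <= n -> f i < n) ->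
  exists i j, [/\ i < j, j <= n & f i = f j].
Proof.
move=> f_lt; have : ~~ uniq [seq f i | i <- iota 0 n.+1].
  apply/negP => /uniq_leq_size le_size.
  have /le_size : {subset [seq f i | i <- iota 0 n.+1] <= iota 0 n}.
    by move=> y /mapP[i]; rewrite !mem_iota /= !add0n => /f_lt ? ->.
  by rewrite size_map !size_iota ltnn.
case/(uniqPn 0) => i [j []]; rewrite size_map size_iota => ij jn.
rewrite !(nth_map 0) ?size_iota ?nth_iota ?add0n; try lia.
by exists i, j.
Qed.

(** A residue modulo [l] is a block number together with an offset below [g], and the offset is the
    residue modulo [g]. So one class modulo [g] contains only [l %/ g] residues modulo [l]. *)
Lemma eqn_mod_block (g l i j : nat) : 0 < g -> g %| l ->
  i = j %[mod g] -> i %% l %/ g = j %% l %/ g -> i = j %[mod l].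
Proof.
move=> g0 gl ij q; rewrite (divn_eq (i %% l) g) (divn_eq (j %% l) g) q.
by congr (_ + _); rewrite !modn_dvdm.
Qed.

Section Walks.
Variables (R : realDomainType) (T : eqType).
Implicit Types (w : T -> T -> R) (e : rel T) (x y z : T) (p q : seq T).

Fixpoint wt w x p : R :=
  if p is y :: p' then (w x y + wt w y p')%R else 0%R.

Lemma wt_cat w x p q : wt w x (p ++ q) = (wt w x p + wt w (last x p) q)%R.
Proof. by elim: p x => [|y p IH] x /=; rewrite ?add0r // IH addrA. Qed.

(** The start is kept apart from the later nodes, so that [size p] is the number of arcs, walks
    compose by [++], and a closed walk is a cycle when [p] is nonempty and [uniq p] holds. *)
Definition walk e x y p := path e x p && (last x p == y).

Lemma walk_nil e x y : walk e x y [::] = (x == y).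
Proof. by []. Qed.

Lemma walk_path e x p : path e x p -> walk e x (last x p) p.
Proof. by rewrite /walk eqxx andbT. Qed.

Lemma walk_cat e x y z p q : walk e x y p -> walk e y z q -> walk e x z (p ++ q).
Proof.
by case/andP=> px /eqP <- /andP[qy /eqP <-]; rewrite /walk cat_path last_cat px qy eqxx.
Qed.

Lemma walk_catE e x z p q :
  walk e x z (p ++ q) = walk e x (last x p) p && walk e (last x p) z q.
Proof. by rewrite /walk cat_path last_cat eqxx andbT andbA. Qed.

Lemma sub_walk e e' x y p : subrel e e' -> walk e x y p -> walk e' x y p.
Proof. by move=> ee' /andP[px l]; rewrite /walk l andbT (sub_path ee'). Qed.

Lemma walk_last e x y p : walk e x y p -> last x p = y.
Proof. by case/andP => _ /eqP. Qed.

Lemma split_at x p y : y \in x :: p -> exists p1 p2, p = p1 ++ p2 /\ last x p1 = y.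
Proof. by case/splitPl => p1 p2 <-; exists p1, p2. Qed.

Lemma path_target e (P : pred T) x p : (forall y z, e y z -> P z) ->
  path e x p -> {in p, forall z, P z}.
Proof.
move=> eP; elim: p x => [//|y p IH] x /= /andP[/eP Py /IH sub] z.
by rewrite inE => /predU1P[->|/sub].
Qed.

Lemma closed_walk_uniq e x p : walk e x x p -> uniq (x :: p) -> p = [::].
Proof.
case: p => [//|y p] /walk_last /= lx /andP[].
by rewrite -{1}lx mem_last.
Qed.

Lemma has_last_cat (P : pred T) x p q : P (last x p) -> has P (x :: p ++ q).
Proof.
move=> Pl; rewrite -cat_cons has_cat; apply/orP; left; apply/hasP.
by exists (last x p); rewrite ?mem_last.
Qed.

Lemma walk_rot e x y p : walk e x x p -> y \in x :: p ->
  exists q, [/\ walk e y y q, size q = size p, {subset p <= q} &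
    forall w, wt w y q = wt w x p].
Proof.
move=> wp /split_at[p1 [p2 [pE l1]]]; rewrite {}pE in wp *.
move: wp; rewrite walk_catE l1 => /andP[wp1 wp2].
exists (p2 ++ p1); split; first exact: walk_cat wp2 wp1.
- by rewrite !size_cat addnC.
- by move=> z; rewrite !mem_cat orbC.
- by move=> w; rewrite !wt_cat l1 (walk_last wp2) addrC.
Qed.

Definition loop_wt w (c : T * seq T) : R := wt w c.1 c.2.

Definition simple_loop e (c : T * seq T) :=
  [&& walk e c.1 c.1 c.2, uniq c.2 & c.2 != [::]].

(** Loop erasure, adding one arc at a time: when the new end already lies on the simple path, the
    part since then is split off as a simple loop. Where the loops were attached is forgotten. *)
Lemma walk_decomposition e w x p : path e x p ->
  exists p0 (cs : seq (T * seq T)),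
    [/\ walk e x (last x p) p0, uniq (x :: p0), all (simple_loop e) cs,
        wt w x p = (wt w x p0 + \sum_(c <- cs) loop_wt w c)%R &
        size p = size p0 + \sum_(c <- cs) size c.2].
Proof.
elim/last_ind: p => [|p y IH].
  by move=> _; exists [::], [::]; split=> //; rewrite ?big_nil ?addr0 ?walk_nil /=.
rewrite rcons_path last_rcons => /andP[/IH[p0 [cs [wp0 up0 hcs wtE szE]]] ey].
have l0 := walk_last wp0.
have wp0' : walk e x y (p0 ++ [:: y]).
  by rewrite walk_catE l0 wp0 /= /walk /= ey eqxx.
have wtE' : wt w x (rcons p y) =
    (wt w x (p0 ++ [:: y]) + \sum_(c <- cs) loop_wt w c)%R.
  by rewrite -cats1 !wt_cat wtE l0 addrAC.
case: (boolP (y \in x :: p0)) => [/split_at[p1 [p2 [pE l1]]]|yNp]; last first.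
  exists (p0 ++ [:: y]), cs; split=> //.
    by rewrite -cat_cons cats1 rcons_uniq yNp.
  by rewrite size_rcons size_cat szE /= addnAC addn1.
exists p1, ((y, p2 ++ [:: y]) :: cs).
move: wp0' wtE'; rewrite pE -catA wt_cat l1 walk_catE l1 => /andP[wp1 wp2] wtE'.
split=> //.
- by move: up0; rewrite pE -cat_cons cat_uniq => /andP[].
- rewrite /= hcs andbT /simple_loop wp2 /=; apply/andP; split; last by case: (p2).
  rewrite cats1 rcons_uniq; move: up0; rewrite pE -cat_cons cat_uniq.
  case/and3P=> _ /hasPn h ->; rewrite andbT; apply/negP => /h.
  by rewrite /= -l1 mem_last.
- by rewrite wtE' big_cons addrA.
- by rewrite size_rcons szE pE big_cons !size_cat /=; lia.
Qed.

(** The first repetition along the walk closes a loop without inner repetition. *)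
Lemma simple_loop_exists x p : ~~ uniq (x :: p) ->
  exists p1 p2 p3, [/\ p = p1 ++ p2 ++ p3, p2 != [::],
    last (last x p1) p2 = last x p1 & uniq p2].
Proof.
elim/last_ind: p => [//|p y IH].
case: (boolP (uniq (x :: p))) => [up|/IH[p1 [p2 [p3 [-> n2 l2 u2]]]] _]; last first.
  by exists p1, p2, (rcons p3 y); rewrite -!rcons_cat.
rewrite -rcons_cons rcons_uniq up andbT negbK => /split_at[p1 [p2 [pE l1]]].
exists p1, (rcons p2 y), [::]; split; rewrite ?cats0 ?last_rcons ?l1 //.
- by rewrite pE rcons_cat.
- by case: (p2).
- rewrite rcons_uniq; move: up; rewrite pE -cat_cons cat_uniq.
  case/and3P=> _ /hasPn h ->; rewrite andbT; apply/negP => /h.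
  by rewrite /= -l1 mem_last.
Qed.

Definition uses_arc (g : rel T) x p :=
  exists p1 y p2, p = p1 ++ y :: p2 /\ g (last x p1) y.

Lemma uses_arc_mid g x y z p q s : walk g y z q -> q != [::] -> last x p = y ->
  uses_arc g x (p ++ q ++ s).
Proof.
case: q => [//|v q]; rewrite /walk /= => /andP[/andP[gv _] _] _ lp.
by exists p, v, (q ++ s); rewrite lp.
Qed.

Lemma uses_arc_cat g x p q s : uses_arc g (last x p) q -> uses_arc g x (p ++ q ++ s).
Proof.
case=> p1 [y [p2 [-> gy]]]; exists (p ++ p1), y, (p2 ++ s).
by rewrite last_cat -!catA.
Qed.

Lemma iter_loop e x p n : walk e x x p -> p != [::] -> 0 < n ->
  exists q, [/\ walk e x x q, q != [::] & n %| size q].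
Proof.
move=> wp p0 n0.
have [q [wq sq]] : exists q, walk e x x q /\ size q = n * size p.
  elim: n {n0} => [|n [q [wq sq]]]; first by exists [::]; rewrite walk_nil.
  by exists (p ++ q); rewrite size_cat sq mulSn; split=> //; apply: walk_cat wp wq.
exists q; split=> //; last by rewrite sq dvdn_mulr.
by rewrite -size_eq0 sq muln_eq0 negb_or -lt0n n0 size_eq0.
Qed.

(* Concatenating the return walks in reverse order closes up any walk made of
   critical arcs into a closed walk of nonnegative weight. *)
Lemma critical_walk_max e (g : rel T) w :
  (forall x p, walk e x x p -> (wt w x p <= 0)%R) ->
  (forall x y, g x y -> exists2 p, walk e y x p & (0 <= w x y + wt w y p)%R) ->
  forall x y p q, walk g x y p -> walk e x y q -> (wt w x q <= wt w x p)%R.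
Proof.
move=> neg ret x y p q wp wq.
have [s ws hs] : exists2 s, walk e y x s & (0 <= wt w x p + wt w y s)%R.
  elim: p x {q wq} wp => [|z p IH] x.
    by rewrite walk_nil => /eqP->; exists [::]; rewrite ?walk_nil //= addr0.
  rewrite /walk /= -andbA => /andP[/ret[s1 ws1 h1] /IH[s2 ws2 h2]].
  exists (s2 ++ s1); first exact: walk_cat ws2 ws1.
  by rewrite wt_cat (walk_last ws2); lra.
have := neg x _ (walk_cat wq ws); rewrite wt_cat (walk_last wq); lra.
Qed.

End Walks.

(** * Class functions *)

(** A choice of cyclic classes. The constant 0 with [gam = 1] fits every relation, so statements
    without cyclicity are special cases. *)
Definition class_function (T : Type) (e : rel T) (gam : nat) (cl : T -> nat) :=
  (forall x, cl x < gam) /\ (forall x y, e x y -> cl y = (cl x).+1 %% gam).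

Section ClassFunction.
Variables (T : eqType) (e : rel T) (gam : nat) (cl : T -> nat).
Hypothesis cl_fun : class_function e gam cl.

Lemma class_last x p : path e x p -> cl (last x p) = (cl x + size p) %% gam.
Proof.
case: cl_fun => cl_lt cl_step.
elim: p x => [|y p IH] x /=; first by rewrite addn0 modn_small.
by case/andP=> /cl_step cly /IH ->; rewrite cly modnDml addSnnS.
Qed.

Lemma last_take x (p : seq T) i : i <= size p ->
  last x (take i p) = nth x (x :: p) i.
Proof.
move=> ip; rewrite (last_nth x) size_takel //.
by rewrite -[x :: take i p]/(take i.+1 (x :: p)) nth_take.
Qed.

Lemma class_nth x p i : path e x p -> i <= size p ->
  cl (nth x (x :: p) i) = (cl x + i) %% gam.
Proof.
move=> px ip; rewrite -last_take // class_last ?size_takel //.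
by move: px; rewrite -{1}(cat_take_drop i p) cat_path => /andP[].
Qed.

(* Two visits to the same node are congruent modulo [gam], so pairwise
   incongruent ones modulo [l] number at most [l %/ gam]. *)
Lemma count_incongruent l x p y i0 : 0 < l -> gam %| l -> path e x p ->
  (forall i j, i < j -> j <= size p -> nth x (x :: p) i = y ->
     nth x (x :: p) j = y -> i = j %[mod l] -> i = i0) ->
  count_mem y (x :: p) <= l %/ gam + ((i0 <= size p) && (nth x (x :: p) i0 == y)).
Proof.
move=> l0 gl px incong; have [cl_lt _] := cl_fun.
have g0 : 0 < gam by apply: leq_ltn_trans (cl_lt x).
set n := size p in incong *; set f := nth x (x :: p) in incong *.
set occ := [seq i <- iota 0 n.+1 | f i == y].
have -> : count_mem y (x :: p) = size occ.
  rewrite size_filter -[x :: p](mkseq_nth x) /mkseq count_map.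
  by apply: eq_count => i; rewrite /= eq_sym.
have uocc : uniq occ by rewrite filter_uniq ?iota_uniq.
set I := [seq i <- occ | i != i0].
have -> : size occ = size I + ((i0 <= n) && (f i0 == y)).
  have -> : (i0 <= n) && (f i0 == y) = (i0 \in occ).
    by rewrite mem_filter mem_iota /= add0n ltnS andbC.
  by rewrite -(count_uniq_mem i0 uocc) [size I]size_filter addnC -[LHS](count_predC (pred1 i0)).
rewrite leq_add2r.
have I_P i : i \in I -> [/\ i != i0, f i = y & i <= n].
  by rewrite !mem_filter mem_iota /= add0n ltnS => /and3P[-> /eqP -> ->].
have key_inj : {in I &, injective (fun i => i %% l %/ gam)}.
  have ordered i j : i \in I -> j \in I -> i < j ->
      i %% l %/ gam = j %% l %/ gam -> False.
    move=> /I_P[ii0 fi li] /I_P[_ fj lj] ij q.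
    apply/negP: ii0; rewrite negbK; apply/eqP; apply: (incong i j) => //.
    apply: (@eqn_mod_block gam) => //; apply/eqP.
    rewrite -(eqn_modDl (cl x)) -(class_nth px li) -(class_nth px lj).
    by rewrite -/f fi fj.
  move=> i j iI jI q; case: (ltngtP i j) => // [/ordered|/ordered] h.
    by case: (h iI jI q).
  by case: (h jI iI (esym q)).
rewrite -[l %/ gam](size_iota 0) -(size_map (fun i => i %% l %/ gam) I).
apply: uniq_leq_size; first by rewrite (map_inj_in_uniq key_inj); apply: filter_uniq.
move=> _ /mapP[i _ ->]; rewrite mem_iota add0n /=.
by rewrite ltn_divLR // divnK // ltn_pmod.
Qed.

Lemma class_visits x p c : path e x p -> c < gam ->
  size (x :: p) <= gam * count (fun y => cl y == c) (x :: p) + gam - 1.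
Proof.
case: cl_fun => cl_lt cl_step px cg.
(* The induction needs the exact number of arcs before the walk can first reach class [c], instead
   of its bound [gam - 1]. *)
suff : size (x :: p) <=
    gam * count (fun y => cl y == c) (x :: p) + (c + (gam - cl x)) %% gam.
  have : (c + (gam - cl x)) %% gam < gam by rewrite ltn_mod; lia.
  by lia.
have dist y : cl y < gam -> (c + (gam - cl y)) %% gam =
    (if cl y <= c then c - cl y else c + gam - cl y).
  move=> yg; case: ifP => h; last by rewrite modn_small; lia.
  have -> : c + (gam - cl y) = c - cl y + gam by lia.
  by rewrite modnDr modn_small; lia.
elim: p x px => [|y p IH] x.
  by move=> _ /=; rewrite dist //; have := cl_lt x; case: eqP; case: ifP => *; lia.
case/andP=> /cl_step cly /IH; rewrite -[size (x :: _)]/(size (y :: p)).+1.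
rewrite -[count _ (x :: _)]/((cl x == c) + count (fun z => cl z == c) (y :: p)).
have := cl_lt x; have := cl_lt y; move: (count _ _) (size _) => n k.
rewrite !dist // => yg xg; rewrite cly in yg *.
have [xl|xl] := leqP gam (cl x).+1.
  have xE : (cl x).+1 = gam by lia.
  by rewrite xE modnn leq0n mulnDr; case: eqP; case: ifP => *; lia.
by rewrite modn_small // mulnDr; case: eqP; case: ifP; case: ifP => *; lia.
Qed.

End ClassFunction.

(** * Walks through critical nodes *)

Lemma modn_addr_dvd l m k : l %| k -> m + k = m %[mod l].
Proof. by case/dvdnP=> j ->; rewrite addnC modnMDl. Qed.

Lemma split_first (T : eqType) (y : T) p : y \in p ->
  exists p1 p2, p = p1 ++ y :: p2 /\ y \notin p1.
Proof.
elim: p => [//|x p IH]; rewrite inE; case: (eqVneq y x) => [->|yx] /=.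
  by exists [::], p.
by case/IH=> p1 [p2 [-> yp1]]; exists (x :: p1), p2; rewrite inE negb_or yx.
Qed.

Lemma split_last (T : eqType) (x y : T) p : y \in x :: p ->
  exists p1 p2, [/\ p = p1 ++ p2, last x p1 = y & y \notin p2].
Proof.
elim/last_ind: p => [|p z IH]; first by rewrite inE => /eqP->; exists [::], [::].
rewrite -rcons_cons mem_rcons inE; case: (eqVneq y z) => [->|yz] /=.
  by exists (rcons p z), [::]; rewrite cats0 last_rcons.
case/IH=> p1 [p2 [-> l1 yp2]]; exists p1, (rcons p2 z).
by rewrite -rcons_cat mem_rcons inE negb_or yz.
Qed.

Lemma cat_eq_cat (T : Type) (p q s t : seq T) :
  p ++ q = s ++ t -> size p <= size s -> exists u, s = p ++ u /\ q = u ++ t.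
Proof.
elim: p s => [|x p IH] [|y s] //=; try by move=> ->; exists [::].
  by move=> ->; exists (y :: s).
by case=> -> /IH h; rewrite ltnS => /h[u [-> ->]]; exists u.
Qed.

Section Shorten.
Variables (R : realDomainType) (T : eqType) (w : T -> T -> R) (e : rel T).
Variables (gam l : nat) (cl : T -> nat).
Hypothesis cl_fun : class_function e gam cl.
Hypotheses (l_gt0 : 0 < l) (gam_dvd_l : gam %| l).
Hypothesis closed_le0 : forall x p, walk e x x p -> (wt w x p <= 0)%R.

(** Visits to [y] other than the one at [i0] happen at pairwise incongruent times, since a closed
    subwalk at [y] of length divisible by [l] can start only at [i0]. The exception costs at most
    one visit. *)
Lemma count_shortcut_free x p y i0 : path e x p ->
  (forall p1 p2 p3, p = p1 ++ p2 ++ p3 -> last x p1 = y -> last y p2 = y ->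
     l %| size p2 -> p2 != [::] -> size p1 = i0) ->
  count_mem y (x :: p) <= l %/ gam + ((i0 <= size p) && (nth x (x :: p) i0 == y)).
Proof.
move=> px free; apply: (count_incongruent cl_fun) => // i j ij jp fi fj ijl.
have ip : i <= size p by lia_arith.
have sz2 : size (take (j - i) (drop i p)) = j - i by rewrite size_takel ?size_drop; lia_arith.
rewrite -(size_takel ip).
apply: (free (take i p) (take (j - i) (drop i p)) (drop j p)).
- by rewrite -{2}(subnK (ltnW ij)) -drop_drop !cat_take_drop.
- by rewrite last_take.
- rewrite -{1}fi -last_take // -last_cat -[RHS]fj -last_take // -takeD subnKC //.
  exact: ltnW.
- by rewrite sz2 -eqn_mod_dvd ?(ltnW ij) //; apply/eqP.
- by rewrite -size_eq0 sz2 subn_eq0 -ltnNge.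
Qed.

(** The removed loop is based at [y], so [y] stays on the shorter walk and a loop set aside at [y]
    can be reattached. *)
Lemma walk_shorten x y p : path e x p -> l %/ gam < count_mem y (x :: p) ->
  exists p' k, [/\ walk e x (last x p) p', y \in x :: p',
    (wt w x p <= wt w x p')%R, size p = size p' + k & (0 < k) && (l %| k)].
Proof.
move=> px many.
have [[p1 [p2 [p3 [pE l1 l2 d2 n2]]]]|none] := pselect (exists p1 p2 p3,
   [/\ p = p1 ++ p2 ++ p3, last x p1 = y, last y p2 = y, l %| size p2 & p2 != [::]]).
  have := walk_path px; rewrite {2}pE !walk_catE l1 l2 => /and3P[w1 w2 w3].
  exists (p1 ++ p3), (size p2); split.
  - exact: walk_cat w1 w3.
  - by rewrite -l1 -cat_cons mem_cat mem_last.
  - by rewrite pE !wt_cat l1 l2; have := closed_le0 w2; lra.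
  - by rewrite pE !size_cat; lia_arith.
  - by rewrite lt0n size_eq0 n2 d2.
suff : count_mem y (x :: p) <= l %/ gam by rewrite leqNgt many.
(* A position beyond the end of the walk: no exception is allowed. *)
have := @count_shortcut_free x p y (size p).+1 px; rewrite ltnn addn0; apply.
by move=> p1 p2 p3 pE l1 l2 d2 n2; case: none; exists p1, p2, p3.
Qed.

End Shorten.

Section ThroughReduction.
Variables (R : realDomainType) (T : eqType) (w : T -> T -> R) (e g : rel T).
Variables (S : pred T) (gam l : nat) (cl : T -> nat).
Hypothesis cl_fun : class_function e gam cl.
Hypotheses (l_gt0 : 0 < l) (gam_dvd_l : gam %| l).
Hypothesis closed_le0 : forall x p, walk e x x p -> (wt w x p <= 0)%R.
Hypothesis g_sub : forall x y, g x y -> [/\ e x y, S x & S y].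
Hypothesis g_max : forall x y p q,
  walk g x y p -> walk e x y q -> (wt w x q <= wt w x p)%R.
Hypothesis g_loop : forall x, S x -> exists2 q, walk g x x q & q != [::].

(** A removal must not destroy the only visit to [S]. Loops at a node of [S] are safe to remove. For
    a node outside [S], either all its visits lie on one side of a visit [z] to [S], or a loop
    around [z] has to be protected; this merges two visits into one, whence the [+ 1]. *)
Lemma walk_through_minimal a b p : walk e a b p -> has S (a :: p) ->
  exists q, [/\ walk e a b q, has S (a :: q), (wt w a p <= wt w a q)%R,
    size q = size p %[mod l] &
    (forall q1 q2 q3, q = q1 ++ q2 ++ q3 -> S (last a q1) ->
       last (last a q1) q2 = last a q1 -> l %| size q2 -> q2 = [::]) /\
    (forall x, ~~ S x -> count_mem x (a :: q) <= l %/ gam + 1)].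
Proof.
move=> wp Sp.
pose P q := [/\ walk e a b q, has S (a :: q), (wt w a p <= wt w a q)%R &
  size q = size p %[mod l]].
have [|q [wq Sq wtq szq] minq] := @exists_minimal (seq T) P size; first by exists p.
exists q; split=> //; split=> [q1 q2 q3 qE Sq1 l2 d2|x NSx].
  apply/eqP; rewrite -size_eq0 -leqn0 leqNgt; apply/negP => q2_gt0.
  move: wq; rewrite qE !walk_catE l2 => /and3P[w1 w2 w3].
  have : P (q1 ++ q3).
    split; first exact: walk_cat w1 w3.
    - exact: has_last_cat.
    - by move: wtq; rewrite qE !wt_cat l2; have := closed_le0 w2; lra.
    - by rewrite -szq qE !size_cat [in RHS]addnCA [in RHS]addnC (modn_addr_dvd _ d2).
  by move/minq; rewrite qE !size_cat; lia_arith.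
rewrite leqNgt; apply/negP => many.
have [z zq Sz] := hasP Sq; have [s [t [qE ls]]] := split_at zq.
move: wq; rewrite qE walk_catE ls => /andP[ws wt_].
have count_split : count_mem x (a :: q) = count_mem x (a :: s) + count_mem x t.
  by rewrite qE -cat_cons count_cat.
have contra s' k : walk e a b s' -> has S (a :: s') -> (wt w a q <= wt w a s')%R ->
    size q = size s' + k -> (0 < k) && (l %| k) -> False.
  move=> ws' Ss' wts' szs' /andP[k0 dk].
  have : P s' by split=> //; [lra | rewrite -szq szs' modn_addr_dvd].
  by move/minq; rewrite szs'; lia_arith.
case: (posnP (count_mem x (a :: s))) => [s0|s_gt0].
  have [||t' [k [wt' _ wtt' szt' kP]]] :=
    walk_shorten cl_fun l_gt0 gam_dvd_l closed_le0 (x := z) (p := t) (y := x).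
  - by case/andP: wt_.
  - by move: many; rewrite count_split s0 /=; lia_arith.
  rewrite (walk_last wt_) in wt'.
  apply: (contra (s ++ t') k) => //; first exact: walk_cat ws wt'.
  - by apply: has_last_cat; rewrite ls.
  - by rewrite qE !wt_cat ls; lra.
  - by rewrite qE !size_cat szt' addnA.
case: (posnP (count_mem x t)) => [t0|t_gt0].
  have [||s' [k [ws' _ wts' szs' kP]]] :=
    walk_shorten cl_fun l_gt0 gam_dvd_l closed_le0 (x := a) (p := s) (y := x).
  - by case/andP: ws.
  - by move: many; rewrite count_split t0; lia_arith.
  rewrite ls in ws'.
  apply: (contra (s' ++ t) k) => //; first exact: walk_cat ws' wt_.
  - by apply: has_last_cat; rewrite (walk_last ws').
  - by rewrite qE !wt_cat ls (walk_last ws'); lra.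
  - by rewrite qE !size_cat szs'; lia_arith.
(* The loop at [x] around [z] is put aside; the rest of the walk still visits
   [x] often enough to be shortened while keeping a visit to [x]. *)
have xs : x \in a :: s by rewrite -has_pred1 has_count.
have xt : x \in t by rewrite -has_pred1 has_count.
have [s1 [s2 [sE ls1 xs2]]] := split_last xs.
have [t1 [t2 [tE xt1]]] := split_first xt.
move: ws wt_; rewrite sE tE -cat_rcons !walk_catE ls1 last_rcons.
case/andP=> ws1 ws2 /andP[wt1 wt2].
have wrest := walk_cat ws1 wt2.
have [||u [k [wu xu wtu szu kP]]] :=
  walk_shorten cl_fun l_gt0 gam_dvd_l closed_le0 (x := a) (p := s1 ++ t2) (y := x).
- by case/andP: wrest.
- move: many; rewrite count_split sE tE -!cat_cons !count_cat.
  have -> : count_mem x s2 = 0 by apply/count_memPn.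
  have -> : count_mem x t1 = 0 by apply/count_memPn.
  by rewrite /= eqxx; lia_arith.
have [u1 [u2 [uE lu1]]] := split_at xu.
rewrite (walk_last wrest) uE walk_catE lu1 in wu; case/andP: wu => wu1 wu2.
have ls2 := walk_last ws2; have lt1 := walk_last wt1.
apply: (contra (u1 ++ (s2 ++ rcons t1 x) ++ u2) k) => //.
- exact: walk_cat wu1 (walk_cat (walk_cat ws2 wt1) wu2).
- rewrite -cat_cons !has_cat; apply/orP; right; apply/orP; left.
  case: (eqVneq s2 [::]) => [s20|s2n].
    by move: ls2 Sz; rewrite s20 /= => <-; rewrite (negPf NSx).
  apply/orP; left; apply/hasP; exists z => //; rewrite -ls2.
  by case: (s2) s2n => //= v s2' _; apply: mem_last.
- move: wtu; rewrite qE uE sE tE -cat_rcons !wt_cat !last_cat ls1 lu1 ls2 last_rcons; lra.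
- by move: szu; rewrite qE uE sE tE !size_cat /= size_rcons; lia_arith.
Qed.

(** The replaced piece [m], possibly empty, and the inserted walk are chosen together. A closed
    subwalk of length divisible by [l] at a node of [S] contradicts the minimality of [V] if it can
    be pulled back to [V], and otherwise the minimality of this choice. The exception is the
    inserted walk as a whole, which must stay nonempty; it accounts for the extra visit to its first
    node [k]. *)
Theorem walk_through_reduction a b p : walk e a b p -> has S (a :: p) ->
  exists q k, [/\ walk e a b q, uses_arc g a q, (wt w a p <= wt w a q)%R,
    size q = size p %[mod l] &
    forall x, count_mem x (a :: q) <= l %/ gam + (if S x then x == k else true)].
Proof.
move=> wp Sp; have [V [wV SV wtV szV [freeV countV]]] := walk_through_minimal wp Sp.
pose P (X : seq T * seq T * seq T * seq T) := let: (p1, m, p2, q) := X in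
  [/\ V = p1 ++ m ++ p2, walk g (last a p1) (last (last a p1) m) q, q != [::] &
      size q = size m %[mod l]].
pose f (X : seq T * seq T * seq T * seq T) := let: (p1, m, p2, q) := X in
  size p1 + size q + size p2.
have [|[[[p1 m] p2] q] [VE wq qn szq] minP] := @exists_minimal _ P f.
  have [z zV Sz] := hasP SV; have [s [t [VE ls]]] := split_at zV.
  have [q0 wq0 q0n] := g_loop Sz; have [q [wq qn dq]] := iter_loop wq0 q0n l_gt0.
  (* An admissible choice: nothing is replaced, and a loop of [g] at a visited node of [S] is
     repeated until its length is divisible by [l]. *)
  exists (s, [::], t, q); split=> //=; first by rewrite ls.
  by rewrite -[size q]add0n modn_addr_dvd.
have min p1' m' p2' q' : V = p1' ++ m' ++ p2' ->
    walk g (last a p1') (last (last a p1') m') q' -> q' != [::] ->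
    size q' = size m' %[mod l] ->
    size p1 + size q + size p2 <= size p1' + size q' + size p2'.
  by move=> h1 h2 h3 h4; apply: (minP (p1', m', p2', q')).
set k := last a p1 in wq; set k' := last k m in wq.
have g_e : subrel g e by move=> x y /g_sub[].
move: (wV); rewrite VE !walk_catE -/k -/k' => /and3P[wp1 wm wp2].
have lq : last k q = k' := walk_last wq.
have wM : walk e a b (p1 ++ q ++ p2).
  exact: walk_cat wp1 (walk_cat (sub_walk g_e wq) wp2).
exists (p1 ++ q ++ p2), k; split=> //.
- exact: uses_arc_mid wq qn erefl.
- apply: le_trans wtV _; rewrite VE !wt_cat -/k -/k' lq.
  by have := g_max wq wm; lra.
- by rewrite -szV VE !size_cat; apply/eqP; rewrite eqn_modDl eqn_modDr; apply/eqP.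
have Sq : {in q, forall x, S x}.
  by apply: (path_target (e := g) (x := k)); [move=> y z /g_sub[] | case/andP: wq].
(* The inserted [q] stays inside [S], so nodes outside [S] are not visited more often than in
   [V]. *)
move=> x; case: ifP => [Sx|/negbT NSx]; last first.
  have := countV _ NSx; rewrite VE -!cat_cons !count_cat addnA.
  have -> : count_mem x q = 0 by apply/count_memPn; apply: contra NSx; apply: Sq.
  by move=> h; apply: leq_trans h; rewrite addnA leq_add2r addn0 leq_addr.
apply: (leq_trans (count_shortcut_free cl_fun l_gt0 gam_dvd_l (i0 := size p1) (y := x) _ _)).
- by case/andP: wM.
- move=> s1 s2 s3 ME ls1 ls2 d2 n2.
  have s2_gt0 : 0 < size s2 by rewrite lt0n size_eq0.
  have := congr1 size ME; rewrite !size_cat => szM.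
  (* The cases follow the positions of the start and of the end of the closed subwalk [s2] relative
     to [p1], [q] and [p2]. *)
  case: (leqP (size p1) (size s1)) => [le1|lt1].
    have [u [s1E {}ME]] := cat_eq_cat ME le1.
    move: ls1; rewrite s1E last_cat -/k => lu.
    have [leu|ltu] := leqP (size q) (size u).
      have [u' [uE p2E]] := cat_eq_cat ME leu.
      have lu' : last k' u' = x by rewrite -lq -(last_cat k q) -uE.
      exfalso; move/eqP: n2; apply; apply: (freeV (p1 ++ m ++ u') s2 s3).
      - by rewrite VE p2E -!catA.
      - by rewrite !last_cat -/k -/k' lu'.
      - by rewrite !last_cat -/k -/k' lu'.
      - by [].
    have [q' [qE s23E]] := cat_eq_cat (esym ME) (ltnW ltu).
    move: wq lq szq minP min; rewrite qE walk_catE last_cat size_cat lu.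
    case/andP=> wu wq' lq' szq minP min.
    have [le2|lt2] := leqP (size s2) (size q').
      have [q'' [q'E _]] := cat_eq_cat s23E le2.
      move: wq' szq; rewrite q'E walk_catE ls2 size_cat => /andP[_ wq''] szq.
      (* Here [s2] lies inside [q]. Cutting it out gives a better [q] unless nothing remains, and
         then [s2] starts at position [size p1]. *)
      case: (eqVneq (u ++ q'') [::]) => [nil|uq''n].
        by case: (u) nil => // _; rewrite cats0.
      have := min p1 m p2 (u ++ q'') VE; rewrite q'E !size_cat => /(_ _ uq''n) le.
      suff : size u + (size s2 + size q'') <= size u + size q'' by lia_arith.
      have := le (walk_cat wu wq''); rewrite -szq.
      have -> : size u + (size s2 + size q'') = size u + size q'' + size s2 by lia_arith.
      by rewrite (modn_addr_dvd _ d2) => /(_ erefl); lia_arith.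
    have [v [s2E p2E]] := cat_eq_cat (esym s23E) (ltnW lt2).
    have lv : last k' v = x by rewrite -lq' -(last_cat x q') -s2E.
    have szu : size u = size (m ++ v) %[mod l].
      apply/eqP; rewrite -(eqn_modDr (size q')) szq size_cat -addnA [size v + _]addnC.
      by rewrite modn_addr_dvd // -size_cat -s2E.
    have VE' : V = p1 ++ (m ++ v) ++ s3 by rewrite VE p2E -!catA.
    (* Here [s2] leaves [q] and ends in [p2], so the prefix [u] of [q] can replace [m ++ v]. If [u]
       is empty, [m ++ v] is a closed subwalk of [V] itself. *)
    exfalso; case: (eqVneq u [::]) => [u0|un].
      have kx : k = x by rewrite -lu u0.
      have := freeV p1 (m ++ v) s3 VE'; rewrite -/k kx last_cat.
      move: lv; rewrite /k' kx => -> /(_ Sx erefl) mv0.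
      have : l %| size (m ++ v) by rewrite /dvdn -szu u0 /= mod0n.
      by case/mv0/(congr1 size); move: lt2; rewrite s2E !size_cat /=; lia_arith.
    have := min p1 (m ++ v) s3 u VE'; rewrite last_cat -/k -/k' lv => /(_ wu un szu).
    by rewrite p2E s2E !size_cat in lt2 *; lia_arith.
  have [u [p1E s23E]] := cat_eq_cat (esym ME) (ltnW lt1).
  have un : 0 < size u by move: lt1; rewrite p1E size_cat; lia_arith.
  have kE : k = last x u by rewrite /k p1E last_cat ls1.
  exfalso; have [le2|lt2] := leqP (size s2) (size u).
    have [u' [uE _]] := cat_eq_cat s23E le2.
    move/eqP: n2; apply; apply: (freeV s1 s2 (u' ++ m ++ p2)); rewrite ?ls1 //.
    by rewrite VE p1E uE -!catA.
  have [u2 [s2E qpE]] := cat_eq_cat (esym s23E) (ltnW lt2).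
  have lu2 : last k u2 = x by rewrite kE -(last_cat x u) -s2E.
  have d2' : l %| size u + size u2 by rewrite -size_cat -s2E.
  (* If [s2] passes over all of [q], putting [m] back yields a closed subwalk of [V]; otherwise the
     suffix [q'] of [q] can replace [u ++ m]. *)
  have [le3|lt3] := leqP (size q) (size u2).
    have [v [u2E p2E]] := cat_eq_cat qpE le3.
    suff /(congr1 size) : u ++ m ++ v = [::] by rewrite size_cat /=; lia_arith.
    apply: (freeV s1 _ s3); rewrite ?ls1 //.
    - by rewrite VE p1E p2E -!catA.
    - by rewrite !last_cat -kE -/k' -lq -(last_cat k q) -u2E.
    move: d2'; rewrite u2E !size_cat /dvdn => /eqP <-; apply/eqP.
    by apply/eqP; rewrite eqn_modDl eqn_modDr; apply/eqP.
  have [q' [qE s3E]] := cat_eq_cat (esym qpE) (ltnW lt3).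
  have q'n : q' != [::].
    by case: (eqVneq q' [::]) => // q'0; move: lt3; rewrite qE q'0 cats0 ltnn.
  have := min s1 (u ++ m) p2 q'; rewrite last_cat ls1 -kE -/k'.
  move: wq; rewrite qE walk_catE lu2 => /andP[_ wq'] le.
  have : size p1 + size (u2 ++ q') + size p2 <= size s1 + size q' + size p2.
    apply: le => //; first by rewrite VE p1E -!catA.
    apply/eqP; rewrite -(eqn_modDr (size u2)).
    have -> : size (u ++ m) + size u2 = size m + (size u + size u2).
      by rewrite size_cat; lia_arith.
    by rewrite (modn_addr_dvd _ d2') -szq qE size_cat addnC.
  by rewrite p1E !size_cat; lia_arith.
- by rewrite leq_add2l -last_take ?size_cat ?leq_addr // take_size_cat // -/k eq_sym.
Qed.

End ThroughReduction.

(** * Hamiltonian critical cycles *)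

(** Among [m] integers some nonempty consecutive block has a sum divisible by [m], by two congruent
    prefix sums. A minimal subfamily with the right total modulo [m] contains no such block; what is
    dropped has weight at most 0. *)
Lemma prune_zero_sum (R : realDomainType) (X : eqType) m (f : X -> nat)
    (v : X -> R) (cs : seq X) : 0 < m -> {in cs, forall c, (v c <= 0)%R} ->
  exists cs', [/\ {subset cs' <= cs}, size cs' < m,
    {in cs', forall c, ~~ (m %| f c)},
    \sum_(c <- cs') f c = \sum_(c <- cs) f c %[mod m] &
    (\sum_(c <- cs) v c <= \sum_(c <- cs') v c)%R].
Proof.
move=> m0 vneg.
pose P cs' := [/\ {subset cs' <= cs},
  \sum_(c <- cs') f c = \sum_(c <- cs) f c %[mod m] &
  (\sum_(c <- cs) v c <= \sum_(c <- cs') v c)%R].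
have [|ds [sub sumf sumv] minP] := @exists_minimal (seq X) P size; first by exists cs; split.
have keep s1 s2 s3 : ds = s1 ++ s2 ++ s3 -> m %| \sum_(c <- s2) f c -> s2 = [::].
  move=> dsE dvd; apply/eqP; rewrite -size_eq0 -leqn0.
  suff : P (s1 ++ s3) by move/minP; rewrite dsE !size_cat; lia_arith.
  have sub2 c : c \in s2 -> c \in cs.
    by move=> cs2; apply: sub; rewrite dsE !mem_cat cs2 orbT.
  split=> [c|/=|/=].
  - by move=> cs13; apply: sub; move: cs13; rewrite dsE !mem_cat => /orP[] ->; rewrite ?orbT.
  - rewrite -sumf dsE !big_cat /= [in RHS]addnCA [in RHS]addnC.
    by rewrite (modn_addr_dvd _ dvd).
  - apply: le_trans sumv _; rewrite dsE !big_cat /=.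
    have : (\sum_(c <- s2) v c <= 0)%R.
      by rewrite big_seq; apply: sumr_le0 => c /sub2/vneg.
    by lra.
exists ds; split=> //; last first.
  move=> c /splitPr dsc; apply/negP => dvd; case: dsc keep => s1 s2 keep.
  by have := keep s1 [:: c] s2 erefl; rewrite big_seq1 => /(_ dvd).
rewrite ltnNge; apply/negP => le.
have [i [j [ij jm]]] := @pigeonhole m
  (fun i => (\sum_(c <- take i ds) f c) %% m) (fun _ _ => ltn_pmod _ m0).
have dsj : take j ds = take i ds ++ take (j - i) (drop i ds).
  by rewrite -takeD subnKC // ltnW.
rewrite dsj big_cat /= => /esym/eqP; rewrite -{2}[\sum_(c <- take i ds) f c]addn0.
rewrite eqn_modDl mod0n => /(keep (take i ds) _ (drop j ds)).
rewrite catA -dsj cat_take_drop => /(_ erefl)/(congr1 size).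
by rewrite size_takel ?size_drop /=; lia_arith.
Qed.

Section Hamiltonian.
Variables (R : realDomainType) (T : eqType) (w : T -> T -> R) (e : rel T).

(** A loop is rotated to a node shared with the walk and inserted there. The walk only gains nodes,
    so the other loops remain attachable. *)
Lemma attach_loops x p (cs : seq (T * seq T)) : path e x p ->
  {in cs, forall c, walk e c.1 c.1 c.2 /\ has (mem (x :: p)) (c.1 :: c.2)} ->
  exists p', [/\ walk e x (last x p) p', size p' = size p + \sum_(c <- cs) size c.2 &
    wt w x p' = (wt w x p + \sum_(c <- cs) loop_wt w c)%R].
Proof.
elim: cs p => [|c cs IH] p px hcs.
  by exists p; rewrite !big_nil addn0 addr0; split=> //; apply: walk_path.
have [wc /hasP[y yc yp]] := hcs c (mem_head _ _).
have [q [wq szq _ wtq]] := walk_rot R wc yc.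
have [p1 [p2 [pE l1]]] := split_at yp.
have := walk_path px; rewrite {2}pE walk_catE l1 => /andP[wp1 wp2].
have wp' := walk_cat wp1 (walk_cat wq wp2).
have [||p' [wp'' szp' wtp']] := IH (p1 ++ q ++ p2); first by case/andP: wp'.
  move=> c' c'cs; have [|wc' /hasP[z zc' zp]] := hcs c'; first by rewrite inE c'cs orbT.
  split=> //; apply/hasP; exists z => //; move: zp; rewrite pE !inE !mem_cat.
  by case/or3P=> ->; rewrite ?orbT.
exists p'; split; first by rewrite -(walk_last wp').
- by rewrite szp' big_cons pE !size_cat szq; lia_arith.
- rewrite wtp' big_cons pE !wt_cat l1 (walk_last wq) wtq /loop_wt; lra.
Qed.

Variables (m : nat) (zs : seq T).
Hypothesis m_gt0 : 0 < m.
Hypothesis size_zs : size zs = m.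
Hypothesis closed_le0 : forall x p, walk e x x p -> (wt w x p <= 0)%R.
Hypothesis e_zs : forall x y, e x y -> y \in zs.
Hypothesis zs_loop : forall x, x \in zs -> exists q,
  [/\ walk e x x q, size q = m, (0 <= wt w x q)%R & {subset zs <= x :: q}].

(* When the remaining path and loops are short there is room for inserting the
   Hamiltonian loop, which meets all loops; otherwise each loop is so long that
   it meets the path itself. *)
Theorem hamiltonian_reduction x p : x \in zs -> path e x p ->
  exists p', [/\ walk e x (last x p) p', (wt w x p <= wt w x p')%R,
    size p' = size p %[mod m] & m <= size p' <= Wi m + m].
Proof.
move=> xz px; have [p0 [cs [wp0 up0 /allP hcs wtE szE]]] := walk_decomposition w px.
have [c /hcs/and3P[wc _ _]|ds [sub szds ndvd sumf sumv]] :=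
  prune_zero_sum (fun c => size c.2) (v := loop_wt w) (cs := cs) m_gt0.
  exact: closed_le0 wc.
have sub0 : {subset p0 <= zs} by have /andP[/(path_target e_zs)] := wp0.
have szp0 : size p0 < m.
  rewrite -size_zs -[_ < _]/(size (x :: p0) <= _); apply: uniq_leq_size up0 _.
  by move=> y; rewrite inE => /predU1P[->//|/sub0].
have ds_P (c : T * seq T) : c \in ds -> [/\ walk e c.1 c.1 c.2, uniq c.2, c.2 != [::],
    {subset c.2 <= zs} & size c.2 < m].
  move=> cds; have /and3P[wc uc nc] := hcs c (sub c cds).
  have subc : {subset c.2 <= zs} by have /andP[/(path_target e_zs)] := wc.
  split=> //; rewrite ltn_neqAle -{2}size_zs (uniq_leq_size uc) // andbT.
  by apply: contra (ndvd c cds) => /eqP ->.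
have sum_le (s : seq (T * seq T)) : {subset s <= ds} ->
    \sum_(c <- s) size c.2 <= size s * (m - 1).
  elim: s => [|c s IH] subs; first by rewrite big_nil.
  rewrite big_cons mulSn; apply: leq_add; last first.
    by apply: IH => d ds'; apply: subs; rewrite inE ds' orbT.
  by have [_ _ _ _ ?] := ds_P c (subs c (mem_head _ _)); lia_arith.
set F := \sum_(c <- ds) size c.2 in sumf.
have sz_mod : size p0 + F = size p %[mod m].
  by rewrite szE -modnDmr sumf modnDmr.
have [small|large] := leqP (size p0 + F) (Wi m).
  have [q [wq szq wtq subq]] := zs_loop xz.
  have wqp := walk_cat wq wp0.
  have [||p' [wp' szp' wtp']] := @attach_loops x (q ++ p0) ds.
  - by case/andP: wqp.
  - move=> c cds; have [wc _ nc subc _] := ds_P c cds; split=> //.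
    apply/hasP; exists c.1; first exact: mem_head.
    suff : c.1 \in x :: q ++ p0 by [].
    rewrite -cat_cons mem_cat subq //; apply: subc.
    rewrite -(walk_last wc); case: (c.2) nc => // y s _ /=; apply: mem_last.
  rewrite (walk_last wqp) in wp'.
  exists p'; split=> //.
  - rewrite wtp' wtE wt_cat (walk_last wq); lra.
  - by rewrite szp' size_cat szq -addnA modnDl.
  - by rewrite szp' size_cat szq -/F; lia_arith.
(* For [m = 1] the path and the kept loops have no arcs, while [Wi 1 = 0]. *)
have m_gt1 : 1 < m.
  rewrite ltnNge; apply/negP => m1; move: large szp0 (sum_le ds (fun c h => h)).
  by rewrite -/F; lia_arith.
have WiE : Wi m = (m - 1) ^ 2 + 1 by rewrite /Wi m_gt1.
have sq : (m - 1) * (m - 1) = (m - 1) + (m - 2) * (m - 1).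
  by rewrite -mulSn; congr (_ * _); lia_arith.
rewrite WiE -mulnn in large.
have [||p' [wp' szp' wtp']] := @attach_loops x p0 ds.
- by case/andP: wp0.
- move=> c cds; have [wc uc nc subc szc] := ds_P c cds; split=> //.
  (* If [c] missed the path, both would share the [m] nodes, so [size p0 + size c.2 <= m - 1]; at
     most [m - 2] other loops have at most [m - 1] arcs each. The total would be at most
     [(m - 1) ^ 2], below [Wi m]. *)
  apply/hasPn => disj.
  have : uniq ((x :: p0) ++ c.2).
    rewrite cat_uniq up0 uc andbT /=; apply/hasPn => y yc.
    by apply: disj; rewrite inE yc orbT.
  move/(@uniq_leq_size _ _ zs); rewrite size_cat size_zs => le.
  have {le} : size (x :: p0) + size c.2 <= m.
    apply: le => y; rewrite mem_cat inE => /orP[/predU1P[->//|/sub0//]|/subc//].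
  have := sum_le _ (fun d => @mem_rem _ c ds d); rewrite size_rem //.
  have FE : F = size c.2 + \sum_(d <- rem c ds) size d.2 by rewrite /F (big_rem c).
  have : (size ds).-1 * (m - 1) <= (m - 2) * (m - 1) by rewrite leq_mul2r; lia_arith.
  move: large; rewrite FE /=; move: (\sum_(d <- _) _) => G; lia_arith.
rewrite (walk_last wp0) in wp'.
exists p'; split=> //.
- by rewrite wtp' wtE; lra.
- by rewrite szp'.
- have le1 : m - 1 <= (m - 1) * (m - 1) by rewrite leq_pmull; lia_arith.
  have le2 : F <= (m - 1) * (m - 1).
    apply: leq_trans (sum_le ds (fun c h => h)) _.
    by rewrite leq_mul2r subn1 -ltnS prednK ?szds ?orbT.
  by rewrite szp' -/F WiE -mulnn; apply/andP; split; lia_arith.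
Qed.

End Hamiltonian.

(** * Critical cycles meeting every cyclic class *)

Lemma sum_class_card (T : finType) gam (cl : T -> nat) : (forall x, cl x < gam) ->
  \sum_(c < gam) #|[pred x | cl x == c]| = #|T|.
Proof.
move=> cl_lt; rewrite -sum1_card.
rewrite (partition_big (fun x => Ordinal (cl_lt x)) predT) //=.
by apply: eq_bigr => c _; rewrite -sum1_card; apply: eq_bigl => x; rewrite inE.
Qed.

Section CycleWalks.
Variables (T : eqType) (g : rel T) (zs : seq T).
Hypotheses (zs_cycle : cycle g zs) (zs_uniq : uniq zs).

Lemma loop_of_cycle x : x \in zs ->
  exists q, [/\ walk g x x q, perm_eq q zs & size q = size zs].
Proof.
move=> xz; have [i s zsE] := rot_to xz.
have pq : perm_eq (rcons s x) zs by rewrite perm_rcons -zsE perm_rot.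
exists (rcons s x); split=> //; last exact: perm_size.
by move: zs_cycle; rewrite -(rot_cycle i) zsE /= /walk last_rcons eqxx => ->.
Qed.

Lemma iter_next x n : x \in zs ->
  iter n (next zs) x = nth x zs ((index x zs + n) %% size zs).
Proof.
move=> xz; have z0 : 0 < size zs by case: (zs) xz.
elim: n => [|n IH]; first by rewrite addn0 modn_small ?index_mem // nth_index.
rewrite iterS IH next_nth mem_nth ?ltn_mod // index_uniq ?ltn_mod //.
rewrite addnS -[_.+1]addn1 -[in RHS](modnDml (index x zs + n)) addn1.
have := ltn_pmod (index x zs + n) z0; move: (_ %% _) => k.
case: (zs) => [//|y s] /=; rewrite ltnS leq_eqVlt => /predU1P[->|ks].
  by rewrite modnn nth_default.
by rewrite modn_small //; apply: set_nth_default.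
Qed.

Lemma cycle_walk x n : x \in zs ->
  exists q, walk g x (nth x zs ((index x zs + n) %% size zs)) q /\ size q = n.
Proof.
move=> xz; rewrite -iter_next //.
exists (traject (next zs) (next zs x) n); rewrite size_traject; split=> //.
elim: n x xz => [|n IH] x xz; first by rewrite walk_nil.
rewrite iterSr trajectS -cat1s; apply: (@walk_cat _ _ _ (next zs x)).
  by rewrite /walk /= (next_cycle zs_cycle) // eqxx.
by apply: IH; rewrite mem_next.
Qed.

End CycleWalks.

(** * Walks in steps of [gam] arcs within one cyclic class *)

Section MacroSteps.
Variables (R : realDomainType) (T : finType) (w : T -> T -> R) (e : rel T).
Variables (gam c : nat) (cl : T -> nat).
Hypothesis cl_fun : class_function e gam cl.

Definition macro_rel : rel T := fun x y =>
  [&& cl x == c, cl y == c & [exists p : gam.-tuple T, walk e x y p]].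

Lemma best_macro_walks : exists bst : T -> T -> seq T, forall x y, macro_rel x y ->
  [/\ walk e x y (bst x y), size (bst x y) = gam &
    forall p, walk e x y p -> size p = gam -> (wt w x p <= wt w x (bst x y))%R].
Proof.
have best (xy : T * T) : exists p : seq T, macro_rel xy.1 xy.2 ->
    [/\ walk e xy.1 xy.2 p, size p = gam & forall p',
      walk e xy.1 xy.2 p' -> size p' = gam -> (wt w xy.1 p' <= wt w xy.1 p)%R].
  case: xy => x y /=; case: (boolP (macro_rel x y)) => [|_]; last by exists [::].
  case/and3P=> _ _ /existsP[p0 wp0].
  case: (@arg_maxP _ _ _ p0 (fun p : gam.-tuple T => walk e x y p)
    (fun p => wt w x p) wp0) => p wp maxp.
  exists p => _; split=> //; first exact: size_tuple.
  by move=> p' wp' /eqP sz; apply: (maxp (Tuple sz)).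
by have [f fP] := choice best; exists (fun x y => f (x, y)) => x y; apply: (fP (x, y)).
Qed.

Variable bst : T -> T -> seq T.
Hypothesis bstP : forall x y, macro_rel x y ->
  [/\ walk e x y (bst x y), size (bst x y) = gam &
    forall p, walk e x y p -> size p = gam -> (wt w x p <= wt w x (bst x y))%R].

Definition macro_wt x y := wt w x (bst x y).

Lemma macro_expand x P : path macro_rel x P -> exists p,
  [/\ walk e x (last x P) p, size p = gam * size P & wt w x p = wt macro_wt x P].
Proof.
elim: P x => [|y P IH] x /=.
  by exists [::]; rewrite walk_nil muln0.
case/andP=> /bstP[wb szb _] /IH[p [wp szp wtp]].
exists (bst x y ++ p); split; first exact: walk_cat wb wp.
  by rewrite size_cat szb szp mulnS.
by rewrite wt_cat (walk_last wb) wtp.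
Qed.

(** The list [P] keeps every [gam]-th node of [p], so a cycle contracts to a loop without inner
    repetition. *)
Lemma macro_contract k x p : cl x = c -> path e x p -> size p = gam * k -> exists P,
  [/\ walk macro_rel x (last x p) P, size P = k, (wt w x p <= wt macro_wt x P)%R,
      {subset P <= p} & uniq p -> uniq P].
Proof.
elim: k x p => [|k IH] x p clx px szp.
  exists [::]; case: p px szp => [|? ?]; last by rewrite muln0.
  by rewrite walk_nil.
have szt : size (take gam p) = gam by rewrite size_takel // szp leq_pmulr.
move: px; rewrite -{1}(cat_take_drop gam p) cat_path => /andP[p1 p2].
set y := last x (take gam p) in p2.
have cly : cl y = c.
  by rewrite (class_last cl_fun p1) szt modnDr clx modn_small // -clx; case: cl_fun.
have mxy : macro_rel x y.
  rewrite /macro_rel clx cly eqxx; apply/existsP.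
  exists (Tuple (introT eqP szt)); exact: walk_path.
have yt : y \in take gam p.
  have g0 : 0 < gam by case: cl_fun => h _; apply: leq_ltn_trans (h x).
  by rewrite /y; case: (take gam p) szt g0 => [<-//|z s _ _]; exact: (mem_last z s).
have [|P [wP szP wtP subP uP]] := IH y (drop gam p) cly p2.
  by rewrite size_drop szp mulnS addKn.
exists (y :: P); split.
- rewrite -cat1s; apply: (@walk_cat _ _ _ y); first by rewrite /walk /= mxy eqxx.
  by rewrite -{1}(cat_take_drop gam p) last_cat.
- by rewrite /= szP.
- rewrite -{1}(cat_take_drop gam p) wt_cat /= lerD //.
  by have [_ _ ->] := bstP mxy; rewrite ?walk_path.
- move=> z; rewrite inE => /predU1P[->|/subP]; last exact: mem_drop.
  exact: mem_take yt.
- rewrite -{1}(cat_take_drop gam p) cat_uniq => /and3P[_ /hasPn disj /uP uP'].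
  rewrite /= uP' andbT; apply/negP => /subP/disj/negP; apply; exact: yt.
Qed.

End MacroSteps.

Section CycleReduction.
Variables (R : realDomainType) (T : finType) (w : T -> T -> R) (e g : rel T).
Variables (gam m : nat) (zs : seq T).
Hypotheses (gam_gt0 : 0 < gam) (m_gt0 : 0 < m) (size_zs : size zs = gam * m).
Hypothesis card_lt : #|T| < gam * m.+1.
Hypothesis closed_le0 : forall x p, walk e x x p -> (wt w x p <= 0)%R.
Hypothesis g_sub : subrel g e.
Hypothesis g_max : forall x y p q,
  walk g x y p -> walk e x y q -> (wt w x q <= wt w x p)%R.
Hypotheses (zs_cycle : cycle g zs) (zs_uniq : uniq zs).

Section FixedClass.
Variable cl : T -> nat.
Hypothesis cl_fun : class_function e gam cl.

Lemma cycle_meets_class c : c < gam -> exists2 x, x \in zs & cl x = c.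
Proof.
move=> cg; have l0 : 0 < size zs by rewrite size_zs muln_gt0 gam_gt0.
have [x0 x0z] : exists x0, x0 \in zs by case: (zs) l0 => // x0 s _; exists x0; apply: mem_head.
have [q [wq szq]] := cycle_walk zs_cycle zs_uniq (c + (gam - cl x0)) x0z.
have [cl_lt _] := cl_fun; have clx0 := cl_lt x0.
exists (nth x0 zs ((index x0 zs + (c + (gam - cl x0))) %% size zs)).
  by rewrite mem_nth // ltn_mod.
rewrite -(walk_last wq) (class_last cl_fun); last by case/andP: (sub_walk g_sub wq).
have -> : cl x0 + size q = c + gam by rewrite szq; lia.
by rewrite modnDr modn_small.
Qed.

(* Along a walk through [m.+1] nodes of the class, the differences between
   position and index in the cycle take only [m] values modulo [gam * m]. *)
Lemma insert_cycle_arc c x p : {subset [pred y | cl y == c] <= zs} -> cl x = c ->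
  path e x p -> gam * m <= size p -> exists q,
  [/\ walk e x (last x p) q, uses_arc g x q, (wt w x p <= wt w x q)%R & size q = size p].
Proof.
move=> sub clx px szp.
have l0 : 0 < gam * m by rewrite muln_gt0 gam_gt0.
have [cl_lt _] := cl_fun.
pose f i := nth x (x :: p) (gam * i).
have ip i : i <= m -> gam * i <= size p.
  by move=> im; apply: leq_trans szp; rewrite leq_mul2l im orbT.
have clf i : i <= m -> cl (f i) = c.
  move=> im; rewrite (class_nth cl_fun px (ip i im)) addnC mulnC modnMDl.
  by rewrite modn_small.
have fz i : i <= m -> f i \in zs by move=> im; apply: sub; rewrite inE clf.
pose phi i := index (f i) zs.
have phi_lt i : i <= m -> phi i < gam * m by move=> /fz; rewrite -size_zs index_mem.
have [x0 x0z x0i] : exists2 x0, x0 \in zs & index x0 zs = 0.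
  by case: (zs) size_zs => [/= h|x0 s _]; [lia | exists x0; rewrite ?mem_head //= eqxx].
have cl_phi i : i <= m -> (cl x0 + phi i) %% gam = c.
  move=> im; rewrite -(clf i im).
  have [q [wq szq]] := cycle_walk zs_cycle zs_uniq (phi i) x0z.
  rewrite -szq -(class_last cl_fun); last by case/andP: (sub_walk g_sub wq).
  rewrite (walk_last wq) x0i add0n modn_small ?size_zs ?phi_lt // /phi.
  by rewrite nth_index ?fz.
(* The summand [gam * m] keeps the subtraction of [phi i] exact in [nat] and vanishes modulo
   [gam * m]. *)
pose d i := gam * i + (gam * m - phi i).
have d_phi i : i <= m -> d i + phi i = gam * (i + m).
  by move=> im; rewrite /d mulnDr; have := phi_lt i im; lia.
have [|i [j [ij jm dij]]] := @pigeonhole m (fun i => d i %% (gam * m) %/ gam).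
  by move=> i _; rewrite ltn_divLR // [m * _]mulnC ltn_pmod.
have im : i <= m by lia.
have {}dij : d i = d j %[mod gam * m].
  apply: (@eqn_mod_block gam) => //; first exact: dvdn_mulr.
  have d_cl n : n <= m -> d n + (cl x0 + phi n) = cl x0 %[mod gam].
    by move=> nm; rewrite addnCA d_phi // mulnC addnC modnMDl.
  apply/eqP; rewrite -(eqn_modDr (cl x0 + phi i)); apply/eqP.
  by rewrite d_cl // -(modnDmr (d j)) cl_phi // -(cl_phi j) // modnDmr d_cl.
have phiE : phi i + gam * (j - i) = phi j %[mod gam * m].
  apply/eqP; rewrite -(eqn_modDl (d j)); apply/eqP.
  rewrite d_phi // -(modnDml (d j)) -dij modnDml addnA d_phi //.
  by rewrite -mulnDr; congr (_ * _ %% _); lia_arith.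
(* Following the cycle from [f i] for [gam * (j - i)] arcs ends at [f j]: a walk of [g] with the
   ends and the length of the piece it replaces. *)
have [q [wq szq]] := cycle_walk zs_cycle zs_uniq (gam * (j - i)) (fz i im).
move: wq; rewrite size_zs phiE modn_small ?phi_lt // nth_index ?fz // => wq.
have gij : gam * i <= gam * j by rewrite leq_mul2l (ltnW ij) orbT.
set s1 := take (gam * i) p; set s3 := drop (gam * j) p.
set s2 := take (gam * (j - i)) (drop (gam * i) p).
have pE : p = s1 ++ s2 ++ s3.
  rewrite /s3 -(subnK gij) -drop_drop -mulnBr /s2 cat_take_drop /s1 cat_take_drop //.
have ls1 : last x s1 = f i by rewrite last_take // ip.
have szs1 : size s1 = gam * i by rewrite size_takel // ip.
have szs2 : size s2 = gam * (j - i).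
  by rewrite size_takel // size_drop mulnBr leq_sub2r // ip.
have ls2 : last (f i) s2 = f j.
  rewrite -ls1 -last_cat /s1 /s2 -takeD mulnBr subnKC //.
  by rewrite last_take // ip.
have := walk_path px; rewrite {2}pE !walk_catE ls1 ls2 => /and3P[w1 w2 w3].
exists (s1 ++ q ++ s3); split.
- exact: walk_cat w1 (walk_cat (sub_walk g_sub wq) w3).
- apply: uses_arc_mid wq _ ls1; rewrite -size_eq0 szq muln_eq0; lia.
- by rewrite pE !wt_cat ls1 ls2 (walk_last wq); have := g_max wq w2; lra.
- by rewrite pE !size_cat szq szs2.
Qed.

(** A class with only [m] nodes is exhausted by its nodes on the cycle, so the cycle contracts to a
    Hamiltonian loop of the macro steps. The reduced macro walk may avoid the arcs of [g]; having at
    least [m] steps, it leaves room for putting one in at constant length. *)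
Lemma class_walk_reduction c x p : #|[pred y | cl y == c]| = m -> cl x = c ->
  path e x p -> gam %| size p -> exists q,
  [/\ walk e x (last x p) q, uses_arc g x q, (wt w x p <= wt w x q)%R,
    size q = size p %[mod gam * m] & size q <= gam * (Wi m + m)].
Proof.
move=> card_c clx px /dvdnP[k]; rewrite mulnC => szp.
have [cl_lt _] := cl_fun.
have [bst bstP] := best_macro_walks w e gam c cl.
pose me := macro_rel e gam c cl; pose mw := macro_wt w bst.
pose D := [pred y | cl y == c].
have me_D y z : me y z -> z \in enum D by rewrite mem_enum inE => /and3P[].
have sizeD : size (enum D) = m by rewrite -cardE.
have macro_loop y : y \in zs -> cl y = c -> exists P, [/\ walk me y y P, size P = m,
    (0 <= wt mw y P)%R, {subset enum D <= P} & {subset P <= zs}].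
  move=> yz cly; have [q [wq pq szq]] := loop_of_cycle zs_cycle yz.
  have weq := sub_walk g_sub wq.
  have [||P [wP szP wtP subP uP]] := macro_contract cl_fun bstP (k := m) cly (p := q).
  - by case/andP: weq.
  - by rewrite szq size_zs.
  rewrite (walk_last wq) in wP.
  have subPD : {subset P <= enum D} by have /andP[/(path_target me_D)] := wP.
  exists P; split=> //.
  - apply: le_trans wtP; apply: (g_max wq (q := [::])).
    by rewrite walk_nil.
  - have uqP : uniq P by apply: uP; rewrite (perm_uniq pq).
    by have [|_ eqPD] := uniq_min_size uqP subPD; [rewrite sizeD szP | move=> z; rewrite eqPD].
  - by move=> z /subP; rewrite (perm_mem pq).
have [y yz cly] : exists2 y, y \in zs & cl y = c.
  by apply: cycle_meets_class; rewrite -clx.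
have Dz : {subset D <= zs}.
  have [P [_ _ _ DP Pz]] := macro_loop y yz cly.
  by move=> z zD; apply: Pz; apply: DP; rewrite mem_enum.
have [P [wP szP wtP _ _]] := macro_contract cl_fun bstP clx px szp.
have [||||P' [wP' wtP' szP' bP']] :=
  @hamiltonian_reduction R T mw me m (enum D) m_gt0 sizeD _ me_D _ x P.
- move=> z Q wQ; have [q [wq _ <-]] := macro_expand bstP (proj1 (andP wQ)).
  by apply: closed_le0; rewrite (walk_last wQ) in wq.
- move=> z; rewrite mem_enum => zD.
  have [|Q [wQ szQ wtQ DQ _]] := macro_loop z (Dz z zD); first exact/eqP.
  by exists Q; split=> // v /DQ; rewrite inE => ->; rewrite orbT.
- by rewrite mem_enum inE clx.
- by case/andP: wP.
rewrite (walk_last wP) in wP'.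
have [p' [wp' szp' wtp']] := macro_expand bstP (proj1 (andP wP')).
rewrite (walk_last wP') in wp'.
have [||q [wq uq wtq szq]] := insert_cycle_arc Dz clx (p := p').
- by case/andP: wp'.
- by rewrite szp' leq_mul2l; case/andP: bP' => ->; rewrite orbT.
rewrite (walk_last wp') in wq.
exists q; split=> //.
- by apply: le_trans wtP _; apply: le_trans wtP' _; rewrite -wtp'.
- by rewrite szq szp' szp -!muln_modr szP' szP.
- by rewrite szq szp' leq_mul2l; case/andP: bP' => _ ->; rewrite orbT.
Qed.

End FixedClass.

(** Each class has at least [m] nodes, and the [rho < gam] nodes in excess cannot enlarge [rho + 1]
    classes. So a class with exactly [m] nodes is reached after [i <= rho] arcs. Head, reduced
    middle and tail have at most [rho + gam * (Wi m + m) + (gam - 1)] arcs, where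
    [rho + gam * m = #|T|]. *)
Theorem cycle_reduction cl0 a p : class_function e gam cl0 -> path e a p ->
  gam * m <= (size p).+1 -> exists q,
  [/\ walk e a (last a p) q, uses_arc g a q, (wt w a p <= wt w a q)%R,
    size q = size p %[mod gam * m] & (size q).+1 <= gam * Wi m + #|T| + gam].
Proof.
move=> cl0_fun px szp.
(* Classes are renumbered so that, for [i < gam], the walk is in class [i] after [i] arcs. *)
have [cl cl_fun cla] : exists2 cl, class_function e gam cl & cl a = 0.
  case: cl0_fun => cl_lt cl_step; have cla := cl_lt a.
  exists (fun x => (cl0 x + (gam - cl0 a)) %% gam); last by rewrite subnKC ?modnn // ltnW.
  split=> [x|x y /cl_step ->]; first by rewrite ltn_mod.
  by rewrite modnDml -[in RHS]addn1 modnDml addn1 addSn.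
have [cl_lt _] := cl_fun.
have card_ge c : c < gam -> m <= #|[pred y | cl y == c]|.
  move=> cg; have [x xz clx] := cycle_meets_class cl_fun cg.
  have [q [wq pq szq]] := loop_of_cycle zs_cycle xz.
  have [bst bstP] := best_macro_walks w e gam c cl.
  have [||P [wP szP _ _ uP]] := macro_contract cl_fun bstP (k := m) clx (p := q).
  - by case/andP: (sub_walk g_sub wq).
  - by rewrite szq size_zs.
  rewrite -szP; have <- : #|P| = size P by apply/card_uniqP/uP; rewrite (perm_uniq pq).
  apply: subset_leq_card; apply/subsetP.
  apply: (path_target (e := macro_rel e gam c cl) (x := x)); last by case/andP: wP.
  by move=> y z /and3P[].
have card_gt : gam * m <= #|T|.
  rewrite -(sum_class_card cl_lt) -[X in X * _]card_ord -sum_nat_const.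
  by apply: leq_sum => c _; apply: card_ge.
set rho := #|T| - gam * m.
have rho_lt : rho < gam by rewrite /rho; move: card_lt; rewrite mulnS; lia_arith.
have [i ir card_i] : exists2 i, i <= rho & #|[pred y | cl y == i]| = m.
  case: (pselect (exists2 i, i <= rho & #|[pred y | cl y == i]| = m)) => // none.
  have : gam * m + rho.+1 <= #|T|; last by rewrite /rho; lia_arith.
  rewrite -(sum_class_card cl_lt).
  have -> : gam * m + rho.+1 = \sum_(c < gam) (m + (c <= rho)).
    rewrite big_split /= sum_nat_const card_ord; congr (_ + _).
    rewrite -(big_mkord predT (fun c => (c <= rho) : nat)) (@big_cat_nat _ _ _ rho.+1) //=.
    rewrite [X in _ + X]big_nat_cond [X in _ + X]big1 => [|c]; last by case: leqP; lia_arith.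
    rewrite addn0 big_nat_cond (eq_bigr (fun _ => 1)) => [|c]; last by case: leqP; lia_arith.
    by rewrite -big_nat_cond sum_nat_const_nat; lia_arith.
  apply: leq_sum => c _; case: (leqP c rho) => [cr|_]; last by rewrite addn0 card_ge.
  rewrite addn1 ltn_neqAle card_ge // andbT; apply/eqP => h.
  by apply: none; exists c.
have gl : gam <= gam * m by rewrite leq_pmulr.
have ip : i <= size p by lia_arith.
set k := (size p - i) %/ gam.
have kp : gam * k <= size (drop i p) by rewrite size_drop mulnC leq_trunc_div.
set s1 := take i p; set s2 := take (gam * k) (drop i p); set s3 := drop (gam * k) (drop i p).
have pE : p = s1 ++ s2 ++ s3 by rewrite !cat_take_drop.
have szs1 : size s1 = i by rewrite size_takel.
have szs2 : size s2 = gam * k by rewrite size_takel.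
have szs3 : size s3 < gam.
  rewrite size_drop size_drop /k mulnC {1}(divn_eq (size p - i) gam) addKn.
  exact: ltn_pmod.
have := walk_path px; rewrite {2}pE !walk_catE => /and3P[w1 w2 w3].
have [|||q [wq uq wtq szq szq_le]] := @class_walk_reduction cl cl_fun i (last a s1) s2 card_i.
- rewrite (class_last cl_fun) ?cla ?szs1 ?add0n ?modn_small //; last by case/andP: w1.
  by lia_arith.
- by case/andP: w2.
- by rewrite szs2 dvdn_mulr.
exists (s1 ++ q ++ s3); split.
- exact: walk_cat w1 (walk_cat wq w3).
- exact: uses_arc_cat.
- by rewrite pE !wt_cat (walk_last wq); lra.
- by rewrite pE !size_cat; apply/eqP; rewrite eqn_modDl eqn_modDr; apply/eqP.
- rewrite !size_cat szs1; have rhoE : rho + gam * m = #|T| by rewrite subnK.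
  move: szq_le szs3; rewrite mulnDr; move: (size q) (size s3) => n1 n3 ? ?.
  by clearbody rho; lia_arith.
Qed.

End CycleReduction.

(** * Graphs of max-plus matrices *)

Section MatrixGraphs.
Variable R : realType.
Implicit Types n m : nat.

Definition finr n m (M : 'M[\bar R]_(n, m)) (i : 'I_n) (j : 'I_m) : bool :=
  M i j != -oo%E.

(** Meaningful only where [finr] holds, since [fine] sends infinite entries to 0. *)
Definition wtr n m (M : 'M[\bar R]_(n, m)) (i : 'I_n) (j : 'I_m) : R :=
  fine (M i j).

Lemma wtrK n m (M : 'M[\bar R]_(n, m)) i j :
  in_Rmax M -> finr M i j -> M i j = (wtr M i j)%:E.
Proof. by move=> hM fM; rewrite /wtr fineK // fin_numE hM andbT. Qed.

Lemma in_Rmax_mul n k m (P : 'M[\bar R]_(n, k)) (Q : 'M[\bar R]_(k, m)) :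
  in_Rmax P -> in_Rmax Q -> in_Rmax (maxplus_mul P Q).
Proof.
move=> hP hQ i j; rewrite mxE -ltey; apply/bigmax_ltP; split=> [|l _].
  by rewrite ltey.
by rewrite lte_add_pinfty // ltey.
Qed.

Lemma finr_mul n k m (P : 'M[\bar R]_(n, k)) (Q : 'M[\bar R]_(k, m)) i l j :
  in_Rmax P -> in_Rmax Q -> finr P i l -> finr Q l j ->
  finr (maxplus_mul P Q) i j /\
  (wtr P i l + wtr Q l j <= wtr (maxplus_mul P Q) i j)%R.
Proof.
move=> hP hQ fP fQ.
have le : ((wtr P i l + wtr Q l j)%:E <= maxplus_mul P Q i j)%E.
  rewrite EFinD -!wtrK // mxE.
  exact: (le_bigmax -oo%E (fun l => P i l + Q l j)%E l).
have fPQ : finr (maxplus_mul P Q) i j.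
  by apply: contraTneq le => ->; rewrite leeNy_eq.
by split=> //; rewrite -lee_fin -wtrK //; apply: in_Rmax_mul.
Qed.

Lemma finr_mul_ex n k m (P : 'M[\bar R]_(n, k)) (Q : 'M[\bar R]_(k, m)) i j :
  in_Rmax P -> in_Rmax Q -> finr (maxplus_mul P Q) i j -> exists l,
  [/\ finr P i l, finr Q l j &
      wtr (maxplus_mul P Q) i j = (wtr P i l + wtr Q l j)%R].
Proof.
move=> hP hQ fPQ.
have k0 : 0 < k.
  by case: k P Q hP hQ fPQ => // P Q _ _; rewrite /finr mxE big_ord0 eqxx.
have [l _ lE] := @eq_bigmax _ _ _ -oo%E (Ordinal k0) predT
  (fun l => P i l + Q l j)%E erefl (fun l _ => leNye _).
exists l; move: (fPQ); rewrite /finr [X in X != _]mxE lE adde_eq_ninfty negb_or.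
case/andP=> fP fQ; split=> //.
by apply: EFin_inj; rewrite -wtrK ?EFinD -?wtrK //; [rewrite mxE | apply: in_Rmax_mul].
Qed.

(** The identity [P (Q P)^n Q = (P Q)^(n+1)] on walks: each arc of [Q P] is opened at an optimal
    middle node and the halves are regrouped into arcs of [P Q]. Regrouping can only gain weight. *)
Lemma path_transfer n m (P : 'M[\bar R]_(n, m)) (Q : 'M[\bar R]_(m, n)) i k j q :
  in_Rmax P -> in_Rmax Q ->
  finr P i k -> path (finr (maxplus_mul Q P)) k q -> finr Q (last k q) j ->
  exists p, [/\ walk (finr (maxplus_mul P Q)) i j p, size p = (size q).+1 &
    (wtr P i k + wt (wtr (maxplus_mul Q P)) k q + wtr Q (last k q) j <=
     wt (wtr (maxplus_mul P Q)) i p)%R].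
Proof.
move=> hP hQ; elim: q i k => [|k' q IH] i k fP /=.
  move=> _ fQ; have [f le] := finr_mul hP hQ fP fQ.
  by exists [:: j]; rewrite /walk /= f eqxx; split=> //; rewrite !addr0.
case/andP=> /(finr_mul_ex hQ hP)[x [fx fx' ->]] /(IH x k' fx')h /h[p [wp szp le]].
have [f le'] := finr_mul hP hQ fP fx.
exists (x :: p); split; last by rewrite /=; lra.
  by move: wp; rewrite /walk /= f.
by rewrite /= szp.
Qed.

Section SquareMatrix.
Variables (d : nat) (A : 'M[\bar R]_d).
Hypothesis hA : in_Rmax A.

Lemma walk_betweenP i j W : reflect (exists2 p, W = i :: p & walk (finr A) i j p)
  (walk_between (mxgraph A) i j W).
Proof.
have arcE : [rel y z | (y, z) \in arcs (mxgraph A)] =2 finr A.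
  by move=> y z; rewrite /= inE.
apply: (iffP idP) => [|[p -> /andP[pi /eqP lp]]].
  case: W => [|x p] //; rewrite /walk_between /= (eq_path arcE) => /andP[/andP[_ px]].
  by case/andP=> /eqP xi /eqP lp; subst x; exists p; rewrite // /walk px lp eqxx.
by rewrite /walk_between /= (eq_path arcE) pi inE lp !eqxx.
Qed.

Lemma weightE i p : path (finr A) i p -> weight A (i :: p) = (wt (wtr A) i p)%:E.
Proof.
elim: p i => [|j p IH] i; first by rewrite /weight big_nil.
rewrite /weight /= => /andP[fij /IH]; rewrite /weight /warcs /= big_cons /= => ->.
by rewrite (wtrK hA) // EFinD.
Qed.

Lemma is_cycleP W : reflect (exists i p,
    [/\ W = i :: p, walk (finr A) i i p, p != [::] & uniq p])
  (is_cycle (mxgraph A) W).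
Proof.
apply: (iffP idP) => [|[i [p [-> wp np up]]]].
  case/and4P; case: W => [//|i p] wW n0 cl up; exists i, p; split=> //.
    have /walk_betweenP[q [<-] //] : walk_between (mxgraph A) i i (i :: p).
    by rewrite /walk_between wW /= eqxx.
  by rewrite -size_eq0 -lt0n.
have /walk_betweenP : exists2 q, i :: p = i :: q & walk (finr A) i i q by exists p.
rewrite /walk_between => /andP[wW _]; rewrite /is_cycle wW up /wlen /= lt0n size_eq0 np.
by rewrite (walk_last wp) eqxx.
Qed.

Lemma cycle_mean_le_lambda c : is_cycle (mxgraph A) c -> (cycle_mean A c <= lambda A)%E.
Proof.
move=> cc; have /is_cycleP[i [p [cE wp np up]]] := cc.
have pd : size p <= d by rewrite -(card_uniqP up) -[X in _ <= X]card_ord max_card.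
have p0 : 0 < size p by rewrite lt0n size_eq0.
have kd : (size p).-1 < d by lia_arith.
have szc : size c == (size p).-1.+2 by rewrite cE /= prednK.
apply: le_trans (le_bigmax _ _ (Ordinal kd)).
exact: (@le_bigmax_cond _ _ _ _ (Tuple szc)
  (fun c => is_cycle (mxgraph A) c) (fun c => cycle_mean A c)).
Qed.

Hypothesis lambda0 : lambda A = 0%E.

Lemma cycle_mean_loop i p : walk (finr A) i i p ->
  cycle_mean A (i :: p) = (wt (wtr A) i p / (size p)%:R)%:E.
Proof. by case/andP=> pi _; rewrite /cycle_mean weightE // EFinM. Qed.

Lemma simple_loop_le0 i p : walk (finr A) i i p -> uniq p -> p != [::] ->
  (wt (wtr A) i p <= 0)%R.
Proof.
move=> wp up np.
have /cycle_mean_le_lambda : is_cycle (mxgraph A) (i :: p) by apply/is_cycleP; exists i, p.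
rewrite lambda0 cycle_mean_loop // lee_fin pmulr_lle0 // invr_gt0 ltr0n.
by rewrite lt0n size_eq0.
Qed.

Lemma closed_walk_le0 i p : walk (finr A) i i p -> (wt (wtr A) i p <= 0)%R.
Proof.
move=> wp.
have [p0 [cs [wp0 up0 /allP hcs -> _]]] :=
  walk_decomposition (wtr A) (proj1 (andP wp)).
rewrite (walk_last wp) in wp0; rewrite (closed_walk_uniq wp0 up0).
rewrite add0r big_seq; apply: sumr_le0 => c /hcs/and3P[wc uc nc].
exact: simple_loop_le0.
Qed.

Lemma is_critical_loop i p : is_critical A (i :: p) <->
  [/\ walk (finr A) i i p, uniq p, p != [::] & wt (wtr A) i p = 0%R].
Proof.
split=> [[/is_cycleP[_ [_ [[<- <-] wp np up]]]]|[wp up np wt0]].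
  rewrite lambda0 cycle_mean_loop // => -[] /eqP.
  by rewrite mulf_eq0 invr_eq0 pnatr_eq0 size_eq0 (negPf np) orbF => /eqP.
by split; [apply/is_cycleP; exists i, p | rewrite lambda0 cycle_mean_loop // wt0 mul0r].
Qed.

Definition arc_rel (G : digraph 'I_d) : rel 'I_d := fun x y => (x, y) \in arcs G.

Lemma walk_arc_rel (G : digraph 'I_d) i j W : walk_between G i j W ->
  exists2 p, W = i :: p & walk (arc_rel G) i j p.
Proof.
case: W => [|x p]; rewrite /walk_between //= => /andP[/andP[_ px]].
by case/andP=> /eqP xi /eqP lp; subst x; exists p; rewrite // /walk px lp eqxx.
Qed.

Lemma arc_rel_walk (G : digraph 'I_d) i j p : i \in nodes G -> walk (arc_rel G) i j p ->
  walk_between G i j (i :: p).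
Proof. by move=> iG /andP[px lp]; rewrite /walk_between /= iG px eqxx lp. Qed.

Lemma warcs_split (T : finType) (i x y : T) p : (x, y) \in warcs (i :: p) ->
  exists p1 p2, p = p1 ++ y :: p2 /\ last i p1 = x.
Proof.
elim: p i => [//|j p IH] i; rewrite /warcs /= inE xpair_eqE => /orP[/andP[/eqP-> /eqP->]|].
  by exists [::], p.
by case/IH=> p1 [p2 [-> l1]]; exists (j :: p1), p2.
Qed.

Lemma mem_warcs_mid (T : finType) (i y : T) p1 p2 :
  (last i p1, y) \in warcs (i :: p1 ++ y :: p2).
Proof.
elim: p1 i => [|j p1 IH] i; rewrite /warcs /= inE ?eqxx //.
by apply/orP; right; apply: IH.
Qed.

(* Making the return walk simple cannot decrease its weight. *)
Lemma arc_critical x y p : finr A x y -> walk (finr A) y x p ->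
  (0 <= wtr A x y + wt (wtr A) y p)%R ->
  (x, y) \in arcs (critical_graph A).
Proof.
move=> fxy wp h.
have [p0 [cs [wp0 up0 /allP hcs wtE _]]] :=
  walk_decomposition (wtr A) (proj1 (andP wp)).
rewrite (walk_last wp) in wp0.
have : (\sum_(c <- cs) loop_wt (wtr A) c <= 0)%R.
  by rewrite big_seq; apply: sumr_le0 => c /hcs/and3P[wc uc nc]; exact: simple_loop_le0.
have wxy : walk (finr A) x x (y :: p0) by move: wp0; rewrite /walk /= fxy.
have := closed_walk_le0 wxy; rewrite /= => le0 le1.
rewrite inE; apply/asboolP; exists (x :: y :: p0); last exact: (@mem_warcs_mid _ x y [::] p0).
by apply/is_critical_loop; split=> //=; lra.
Qed.

Lemma critical_arc_return x y : (x, y) \in arcs (critical_graph A) ->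
  finr A x y /\ exists2 p, walk (finr A) y x p & (0 <= wtr A x y + wt (wtr A) y p)%R.
Proof.
rewrite inE => /asboolP[[|i p]]; first by case=> /is_cycleP[i [p []]].
case/is_critical_loop=> wp up np wt0 /warcs_split[p1 [p2 [pE l1]]].
move: wp wt0; rewrite pE walk_catE l1 wt_cat l1 => /andP[wp1].
rewrite /walk /= -andbA => /and3P[fxy py /eqP lp] wt0; split=> //.
exists (p2 ++ p1); first by apply: (@walk_cat _ _ _ i); [rewrite /walk py lp eqxx | ].
by rewrite wt_cat lp; lra.
Qed.

(** The rest of the closed walk, read from the end of an arc, is a return walk that makes this arc
    critical. *)
Lemma critical_arcs i p : walk (finr A) i i p -> (0 <= wt (wtr A) i p)%R ->
  path (arc_rel (critical_graph A)) i p.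
Proof.
move=> wp h; have arc p1 y p2 : p = p1 ++ y :: p2 -> arc_rel (critical_graph A) (last i p1) y.
  move=> pE; move: wp h; rewrite pE walk_catE wt_cat => /andP[wp1].
  rewrite /walk /= -andbA => /and3P[fxy py /eqP lp] h.
  apply: (@arc_critical _ _ (p2 ++ p1)) => //.
    by apply: (@walk_cat _ _ _ i); [rewrite /walk py lp eqxx | ].
  by rewrite wt_cat lp; lra.
elim: p i {wp h} arc => [//|y p IH] i arc /=; rewrite (arc [::] y p erefl) /=.
by apply: IH => p1 z p2 pE; apply: (arc (y :: p1) z p2); rewrite pE.
Qed.

End SquareMatrix.
End MatrixGraphs.

(** * Lifts of critical subgraphs *)

Section CriticalLifts.
Variables (R : realType) (d r : nat).
Variables (U : 'M[\bar R]_(d, r)) (L : 'M[\bar R]_(r, d)) (G : digraph 'I_d).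
Hypotheses (hU : in_Rmax U) (hL : in_Rmax L).
Local Notation A := (maxplus_mul U L).
Local Notation C := (maxplus_mul L U).
Hypothesis lambda0 : lambda A = 0%E.
Hypothesis G_critical : subgraph G (critical_graph A).
Hypothesis G_connected : strongly_connected G.

Let hA : in_Rmax A := in_Rmax_mul hU hL.
Let hC : in_Rmax C := in_Rmax_mul hL hU.

Lemma subgraph_arc_return x y : arc_rel G x y -> finr A x y /\
  exists2 p, walk (finr A) y x p & (0 <= wtr A x y + wt (wtr A) y p)%R.
Proof.
by case/andP: G_critical => _ /subsetP sub /sub; apply: critical_arc_return.
Qed.

Lemma subgraph_sub : subrel (arc_rel G) (finr A).
Proof. by move=> x y /subgraph_arc_return[]. Qed.

Lemma subgraph_walk_max x y p q : walk (arc_rel G) x y p -> walk (finr A) x y q ->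
  (wt (wtr A) x q <= wt (wtr A) x p)%R.
Proof.
apply: critical_walk_max; first exact: closed_walk_le0.
by move=> u v /subgraph_arc_return[].
Qed.

Lemma subgraph_closed_ge0 x p : walk (arc_rel G) x x p -> (0 <= wt (wtr A) x p)%R.
Proof.
by move=> wp; apply: (subgraph_walk_max wp (q := [::])); rewrite walk_nil.
Qed.

Lemma subgraph_connect x y : x \in nodes G -> y \in nodes G ->
  exists p, walk (arc_rel G) x y p.
Proof. by move=> xG yG; have [W /walk_arc_rel[p _ wp]] := G_connected xG yG; exists p. Qed.

(** Opened at an optimal middle node of its first arc, a closed walk on [C] regroups into a closed
    walk on [A] of at least the same weight. *)
Lemma closed_walk_dual_le0 k q : walk (finr C) k k q -> (wt (wtr C) k q <= 0)%R.
Proof.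
case: q => [//|k' q]; rewrite /walk /= -andbA => /and3P[fkk' pq /eqP lq].
have [x [fx fx' ->]] := finr_mul_ex hL hU fkk'.
have [|p [wp _ le]] := path_transfer (j := x) hU hL fx' pq; first by rewrite lq.
have := closed_walk_le0 hA lambda0 wp; rewrite lq in le; lra.
Qed.

Definition lifts (k : 'I_r) (x y : 'I_d) : bool :=
  [&& arc_rel G x y, finr U x k, finr L k y &
      wtr A x y == (wtr U x k + wtr L k y)%R].

Definition lift_node : pred 'I_r := fun k => [exists x, exists y, lifts k x y].

Definition lift_arc : rel 'I_r := fun k k' =>
  [exists y, [exists x, lifts k x y] && [exists z, lifts k' y z]].

Lemma lift_arcP k k' : reflect (exists x y z, lifts k x y /\ lifts k' y z) (lift_arc k k').
Proof.
apply: (iffP existsP) => [[y /andP[/existsP[x h1] /existsP[z h2]]]|[x [y [z [h1 h2]]]]].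
  by exists x, y, z.
by exists y; apply/andP; split; apply/existsP; [exists x | exists z].
Qed.

Lemma lift_nodeP k : reflect (exists x y, lifts k x y) (lift_node k).
Proof.
apply: (iffP existsP) => [[x /existsP[y h]]|[x [y h]]]; first by exists x, y.
by exists x; apply/existsP; exists y.
Qed.

Lemma lift_exists x y : arc_rel G x y -> exists k, lifts k x y.
Proof.
move=> xy; have [k [fU fL wE]] := finr_mul_ex hU hL (subgraph_sub xy).
by exists k; rewrite /lifts xy fU fL wE eqxx.
Qed.

Lemma arc_rel_nodes x y : arc_rel G x y -> x \in nodes G /\ y \in nodes G.
Proof. by move/arcs_nodes/andP. Qed.

(** The two arcs of [G] are completed to a closed walk of [G], which regroups into a closed walk on
    [C]. The last bound uses the sum through [y] instead of the arc weight of [C]: this stronger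
    form later shows that the two are equal. *)
Lemma lift_arc_return k x y k' z : lifts k x y -> lifts k' y z ->
  [/\ finr C k k', (wtr L k y + wtr U y k' <= wtr C k k')%R &
   exists2 q, walk (finr C) k' k q &
     (0 <= (wtr L k y + wtr U y k') + wt (wtr C) k' q)%R].
Proof.
case/and4P=> xy fxk fky /eqP wxy /and4P[yz fyk' fk'z /eqP wyz].
have [fkk' le] := finr_mul hL hU fky fyk'; split=> //.
have [_ zG] := arc_rel_nodes yz; have [xG _] := arc_rel_nodes xy.
have [p wp] := subgraph_connect zG xG.
have wpA := sub_walk subgraph_sub wp.
have [|q [wq _ leq]] := path_transfer (j := k) hL hU fk'z (proj1 (andP wpA)).
  by rewrite (walk_last wp).
exists q => //; rewrite (walk_last wp) in leq.
have : (0 <= wt (wtr A) x (y :: z :: p))%R.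
  by apply: subgraph_closed_ge0; move: wp; rewrite /walk /= -/(arc_rel G x y) xy yz.
rewrite /= wxy wyz; lra.
Qed.

Lemma lift_arc_sub : subrel lift_arc (finr C).
Proof. by move=> k k' /lift_arcP[x [y [z [h1 h2]]]]; have [] := lift_arc_return h1 h2. Qed.

Lemma lift_walk_max k k' p q : walk lift_arc k k' p -> walk (finr C) k k' q ->
  (wt (wtr C) k q <= wt (wtr C) k p)%R.
Proof.
apply: critical_walk_max; first exact: closed_walk_dual_le0.
move=> j j' /lift_arcP[x [y [z [h1 h2]]]].
by have [_ le [q' wq' ge]] := lift_arc_return h1 h2; exists q' => //; lra.
Qed.

(** If the arc of [C] weighed more than the sum through [y], it would close up with the return walk
    to a positive weight. *)
Lemma lift_arc_mid k k' : lift_arc k k' -> exists y,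
  [/\ y \in nodes G, finr L k y, finr U y k' & wtr C k k' = (wtr L k y + wtr U y k')%R].
Proof.
case/lift_arcP=> x [y [z [h1 h2]]]; have [fkk' le [q wq ge]] := lift_arc_return h1 h2.
exists y; case/and4P: h1 => /arc_rel_nodes[_ yG] _ fky _; case/and4P: h2 => _ fyk' _ _.
split=> //; have : (wt (wtr C) k (k' :: q) <= 0)%R.
  by apply: closed_walk_dual_le0; move: wq; rewrite /walk /= fkk'.
rewrite /=; lra.
Qed.

Lemma lift_arc_nodes k k' : lift_arc k k' -> lift_node k /\ lift_node k'.
Proof.
by case/lift_arcP=> x [y [z [h1 h2]]]; split; apply/lift_nodeP; [exists x, y | exists y, z].
Qed.

Lemma lift_chain k x y p x' k' y' : lifts k x y -> walk (arc_rel G) y x' p ->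
  lifts k' x' y' -> exists2 q, walk lift_arc k k' q & size q = (size p).+1.
Proof.
elim: p k x y => [|z p IH] k x y h.
  rewrite walk_nil => /eqP <- h'; exists [:: k'] => //.
  by rewrite /walk /= eqxx !andbT; apply/lift_arcP; exists x, y, y'.
rewrite /walk /= -andbA => /andP[yz wp] h'.
have [k1 h1] := lift_exists yz; have [q wq sq] := IH k1 y z h1 wp h'.
exists (k1 :: q); last by rewrite /= sq.
move: wq; rewrite /walk /= -andbA => ->; rewrite andbT.
by apply/lift_arcP; exists x, y, z.
Qed.

Lemma lift_loop k : lift_node k -> exists2 q, walk lift_arc k k q & q != [::].
Proof.
case/lift_nodeP=> x [y h]; have /and4P[/arc_rel_nodes[xG yG] _ _ _] := h.
have [p wp] := subgraph_connect yG xG; have [q wq sq] := lift_chain h wp h.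
by exists q; rewrite // -size_eq0 sq.
Qed.

Lemma subgraph_loop y : y \in nodes G -> arcs G != set0 ->
  exists2 p, walk (arc_rel G) y y p & p != [::].
Proof.
move=> yG /set0Pn[[u v] uv]; have [uG vG] := arc_rel_nodes uv.
have [p1 w1] := subgraph_connect yG uG; have [p2 w2] := subgraph_connect vG yG.
exists (p1 ++ v :: p2); last by case: (p1).
apply: walk_cat w1 _; move: w2; rewrite /walk /=; case/andP=> -> ->.
by rewrite !andbT.
Qed.

(** The identity [A^n U = U C^n] on walks. The half arc at [y] is prescribed, so a chosen index [k]
    can be forced into a lift. *)
Lemma half_lift_left i y p k : walk (finr A) i y p -> finr U y k ->
  exists k0 q, [/\ finr U i k0, walk (finr C) k0 k q, size q = size p &
    (wt (wtr A) i p + wtr U y k <= wtr U i k0 + wt (wtr C) k0 q)%R].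
Proof.
case: p => [|j p]; first by rewrite walk_nil => /eqP -> fU; exists k, [::];
  rewrite walk_nil /= addr0 add0r.
rewrite /walk /= -andbA => /and3P[fij pj /eqP lp] fU.
have [k0 [fik fkj wE]] := finr_mul_ex hU hL fij.
have [|q [wq sq le]] := path_transfer (j := k) hL hU fkj pj; first by rewrite lp.
exists k0, q; split=> //; rewrite wE; rewrite lp in le; lra.
Qed.

Lemma half_lift_right k y p b : finr L k y -> walk (finr A) y b p ->
  exists q, [/\ path (finr C) k q, finr L (last k q) b, size q = size p &
    (wtr L k y + wt (wtr A) y p <= wt (wtr C) k q + wtr L (last k q) b)%R].
Proof.
case/lastP: p => [|p j] fL.
  by rewrite walk_nil => /eqP <-; exists [::]; rewrite /= addr0 add0r.
rewrite -cats1 walk_catE => /andP[wp]; rewrite /walk /= andbT => /andP[fj /eqP <-].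
have [k0 [fik fkj wE]] := finr_mul_ex hU hL fj.
have [q [wq sq le]] := path_transfer (j := k0) hL hU fL (proj1 (andP wp)) fik.
exists q; rewrite (walk_last wq); split=> //; first by case/andP: wq.
  by rewrite size_cat sq addn1.
rewrite wt_cat /= wE; lra.
Qed.

(** A walk visiting a node of [G] may use no arc of [G], so a closed walk of [G] of length divisible
    by [l] is inserted at the visit. Cutting its first arc at an index lifting that arc forces the
    lift through a lifted node. The insertion also makes the walk at least [l] long. *)
Lemma walk_through_lift l i b p : 0 < l -> arcs G != set0 -> walk (finr A) i b p ->
  through G (i :: p) -> exists k q,
  [/\ finr U i k, path (finr C) k q, finr L (last k q) b, has lift_node (k :: q) &
   [/\ (wt (wtr A) i p <= wtr U i k + wt (wtr C) k q + wtr L (last k q) b)%R,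
     (size q).+1 = size p %[mod l] & l <= (size q).+1]].
Proof.
move=> l0 arcsG wp /hasP[y yp yG].
have [p0 wp0 np0] := subgraph_loop yG arcsG.
have [p' [wp' np' dp']] := iter_loop wp0 np0 l0.
have [p1 [p2 [pE l1]]] := split_at yp.
move: wp; rewrite pE walk_catE l1 => /andP[w1 w2].
have ge0 := subgraph_closed_ge0 wp'.
case: p' wp' np' dp' ge0 => [//|y1 p']; rewrite {1}/walk /= -andbA => /andP[yy1 wp'] _ dp' ge0.
have [k /and4P[_ fU fL /eqP wE]] := lift_exists yy1.
have [k0 [q1 [fU0 wq1 sq1 le1]]] := half_lift_left w1 fU.
have [q2 [pq2 fL2 sq2 le2]] := half_lift_right fL (walk_cat (sub_walk subgraph_sub wp') w2).
have lq1 := walk_last wq1.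
exists k0, (q1 ++ q2); rewrite last_cat lq1; split=> //.
- by rewrite cat_path lq1 pq2 andbT; case/andP: wq1.
- rewrite -[_ || _]/(has lift_node ((k0 :: q1) ++ q2)) has_cat.
  apply/orP; left; apply/hasP; exists k.
    by rewrite -lq1 mem_last.
  by apply/lift_nodeP; exists y, y1; rewrite /lifts yy1 fU fL wE eqxx.
split.
- move: le1 le2; rewrite !wt_cat l1 lq1 (walk_last wp') wE in ge0 *; lra.
- have -> : (size (q1 ++ q2)).+1 = size p + size (y1 :: p').
    by rewrite pE !size_cat sq1 sq2 size_cat /=; lia_arith.
  by rewrite modn_addr_dvd // -pE.
- have := dvdn_leq (ltn0Sn _) dp'; rewrite size_cat sq1 sq2 size_cat /=; lia_arith.
Qed.

(** The lifted arc is opened at its middle node in [G]; the two remaining pieces are regrouped with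
    arbitrary optimal middle nodes. *)
Lemma walk_through_unlift i k q b : finr U i k -> path (finr C) k q ->
  finr L (last k q) b -> uses_arc lift_arc k q -> exists p,
  [/\ walk (finr A) i b p, through G (i :: p), size p = (size q).+1 &
   (wtr U i k + wt (wtr C) k q + wtr L (last k q) b <= wt (wtr A) i p)%R].
Proof.
move=> fU pq fL [q1 [k' [q2 [qE g1]]]].
have [y [yG fky fyk' wE]] := lift_arc_mid g1.
move: pq fL; rewrite qE cat_path last_cat /= => /and3P[pq1 _ pq2] fL.
have [p1 [w1 s1 le1]] := path_transfer hU hL fU pq1 fky.
have [p2 [w2 s2 le2]] := path_transfer hU hL fyk' pq2 fL.
have thr : through G ((i :: p1) ++ p2).
  by apply/hasP; exists y => //; rewrite mem_cat -(walk_last w1) mem_last.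
exists (p1 ++ p2); split=> //.
- exact: walk_cat w1 w2.
- by rewrite !size_cat s1 s2 /=; lia_arith.
- rewrite !wt_cat (walk_last w1) /= wE; lra.
Qed.

(** A walk on [A] has one arc more than its counterpart on [C], whence the successors. *)
Lemma Twr_bound l B : 0 < l -> arcs G != set0 ->
  (forall k q, path (finr C) k q -> has lift_node (k :: q) -> l <= (size q).+1 ->
    exists q', [/\ walk (finr C) k (last k q) q', uses_arc lift_arc k q',
      (wt (wtr C) k q <= wt (wtr C) k q')%R, size q' = size q %[mod l] &
      (size q').+1 <= B]) ->
  exists2 T, is_Twr A G l T & T <= B.
Proof.
move=> l0 arcsG reduce.
have red : walk_reducing A G l B.
  move=> i b W /walk_betweenP[p -> wp] thr _.
  have [k [q [fU pq fL Sq [le sz lq]]]] := walk_through_lift l0 arcsG wp thr.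
  have [q' [wq' uq' leq' szq' Bq']] := reduce k q pq Sq lq.
  rewrite -(walk_last wq') in fL.
  have [p' [wp' thr' szp' lep']] := walk_through_unlift fU (proj1 (andP wq')) fL uq'.
  exists (i :: p'); split=> //.
  - by apply/walk_betweenP; exists p'.
  - rewrite (weightE hA (proj1 (andP wp))) (weightE hA (proj1 (andP wp'))).
    rewrite lee_fin; rewrite (walk_last wq') in lep'; lra.
  - by rewrite /wlen /= szp' -sz -addn1 -modnDml szq' modnDml addn1.
  - by rewrite /wlen /= szp'.
have exT : exists T, `[< walk_reducing A G l T >] by exists B; apply/asboolP.
case: (ex_minnP exT) => T /asboolP redT minT; exists T.
  by split=> // T' redT'; apply: minT; apply/asboolP.
by apply: minT; apply/asboolP.
Qed.

End CriticalLifts.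

(** * Factor rank, cyclicity and related subgraphs *)

(** An index through which no finite sum passes could be deleted from both factors. *)
Lemma factor_rank_alive (R : realType) (d r : nat) (U : 'M[\bar R]_(d, r))
    (L : 'M[\bar R]_(r, d)) : in_Rmax U -> in_Rmax L ->
  is_factor_rank (maxplus_mul U L) r ->
  forall k, exists ij : 'I_d * 'I_d, finr U ij.1 k && finr L k ij.2.
Proof.
case: r U L => [|r] U L hU hL [_ minr] k; first by case: k.
have [//|none] := pselect (exists ij : 'I_d * 'I_d, finr U ij.1 k && finr L k ij.2).
suff /minr : factorizable (maxplus_mul U L) r by rewrite ltnn.
exists (col' k U), (row' k L); split=> [i j|i j|]; rewrite ?mxE //.
apply/matrixP => i j; rewrite !mxE (bigD1_ord k) //=.
have -> : (U i k + L k j = -oo)%E.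
  apply/eqP; rewrite adde_eq_ninfty; apply/negPn/negP; rewrite negb_or => h.
  by apply: none; exists (i, j).
by rewrite maxNye; apply: eq_bigr => l _; rewrite !mxE.
Qed.

Section Cyclicity.
Variables (R : realType) (d : nat) (A : 'M[\bar R]_d).
Hypothesis hA : in_Rmax A.

Lemma cyclicity_dvd i p : walk (finr A) i i p -> cyclicity (mxgraph A) %| size p.
Proof.
move=> wp.
have [p0 [cs [wp0 up0 /allP hcs _ ->]]] := walk_decomposition (wtr A) (proj1 (andP wp)).
rewrite (walk_last wp) in wp0; rewrite (closed_walk_uniq wp0 up0).
rewrite add0n big_seq; apply: dvdn_sum => c /hcs/and3P[wc uc nc].
have szc : size c.2 < #|'I_d|.+1 by rewrite ltnS -(card_uniqP uc) max_card.
apply: (biggcdn_inf (Ordinal szc)) => //.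
rewrite inE; apply/asboolP; exists (c.1 :: c.2) => //.
by apply/is_cycleP; exists c.1, c.2.
Qed.

(** The class of [x] is the length modulo [gam] of a chosen walk from [i0] to [x]; completing walks
    by a common return walk compares their lengths. The nonempty closed walk excludes [gam = 0], the
    gcd of no lengths. *)
Lemma cyclicity_class_function : irreducible A ->
  (exists i p, walk (finr A) i i p /\ p != [::]) ->
  exists cl, class_function (finr A) (cyclicity (mxgraph A)) cl.
Proof.
move=> irr [i0 [p0 [wp0 np0]]]; set gam := cyclicity _.
have g0 : 0 < gam.
  move: (cyclicity_dvd wp0); rewrite -/gam; case: gam => //.
  by rewrite dvd0n size_eq0 (negPf np0).
have conn i j : exists p, walk (finr A) i j p.
  by have [||W /walk_betweenP[p _ wp]] := irr i j; rewrite ?inE //; exists p.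
have [f fP] := choice (conn i0).
exists (fun x => size (f x) %% gam); split=> [x|x y xy]; first by rewrite ltn_mod.
have [b wb] := conn y i0.
have h1 : gam %| size (f x) + (size b).+1.
  have := @cyclicity_dvd i0 (f x ++ y :: b); rewrite size_cat; apply.
  by apply: walk_cat (fP x) _; move: wb; rewrite /walk /= xy.
have h2 : gam %| size (f y) + size b.
  by rewrite -size_cat; apply: (@cyclicity_dvd i0); apply: walk_cat (fP y) wb.
apply/eqP; rewrite -[_.+1]addn1 modnDml -(eqn_modDr (size b)) -addnA add1n.
by move: h1 h2; rewrite /dvdn => /eqP -> /eqP ->.
Qed.

End Cyclicity.

(** An index [k] gets the class of a node [i] with [U i k] finite. All such nodes have the same
    class, as each has an arc of [A] to one common [j] with [L k j] finite. *)
Lemma dual_class_function (R : realType) (d r : nat) (U : 'M[\bar R]_(d, r))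
    (L : 'M[\bar R]_(r, d)) gam clA : in_Rmax U -> in_Rmax L ->
  (forall k, exists ij : 'I_d * 'I_d, finr U ij.1 k && finr L k ij.2) ->
  class_function (finr (maxplus_mul U L)) gam clA ->
  exists cl, class_function (finr (maxplus_mul L U)) gam cl.
Proof.
move=> hU hL /choice[f fP] [clA_lt clA_step].
exists (fun k => clA (f k).1); split=> // k k' /(finr_mul_ex hL hU)[x [fx fx' _]].
have /andP[fk _] := fP k; have /andP[fk' fk'2] := fP k'.
have [xk _] := finr_mul hU hL fk fx; rewrite -(clA_step _ _ xk).
have [h1 _] := finr_mul hU hL fx' fk'2; have [h2 _] := finr_mul hU hL fk' fk'2.
have /eqP := etrans (esym (clA_step _ _ h1)) (clA_step _ _ h2).
by rewrite -[(clA x).+1]addn1 -[(clA _).+1]addn1 eqn_modDr !modn_small // => /eqP.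
Qed.

Lemma sum_count_mem (T : finType) (P : pred T) (s : seq T) :
  \sum_(x | P x) count_mem x s = count P s.
Proof.
elim: s => [|y s IH] /=; first by rewrite big1.
rewrite big_split /= IH; congr (_ + _).
rewrite big_mkcond (bigD1 y) //= big1 ?addn0 => [|x xy]; first by rewrite eqxx; case: (P y).
by rewrite eq_sym (negPf xy); case: (P x).
Qed.

(** Each node of [S] saves one visit, and [P k] pays for the spliced one. *)
Lemma count_visits_le (T : finType) (P S : pred T) (s : seq T) n k :
  (forall x, count_mem x s <= n + (if S x then x == k else true)) ->
  count P s + #|[predI P & S]| <= #|P| * n + #|P| + P k.
Proof.
move=> cnt; rewrite -sum_count_mem.
have le : \sum_(x | P x) count_mem x s <=
    \sum_(x | P x) (n + ((x == k) + ~~ S x)).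
  by apply: leq_sum => x _; apply: leq_trans (cnt x) _; case: (S x) => /=; lia_arith.
apply: leq_trans (leq_add le (leqnn _)) _.
rewrite !big_split /= sum_nat_const -!addnA leq_add2l.
have -> : \sum_(x | P x) (x == k) = P k.
  rewrite big_mkcond (bigD1 k) //= eqxx big1 ?addn0 => [|x xk]; first by case: (P k).
  by rewrite (negPf xk); case: (P x).
rewrite addnC leq_add2r -(cardID S P) addnC leq_add2l.
rewrite -big_mkcondr sum1_card.
by apply: subset_leq_card; apply/subsetP => x; rewrite !inE andbC.
Qed.

(** * The related subgraph and the lifted nodes *)

Section RelatedGraph.
Variables (R : realType) (d r : nat).
Variables (U : 'M[\bar R]_(d, r)) (L : 'M[\bar R]_(r, d)) (G : digraph 'I_d).
Hypotheses (hU : in_Rmax U) (hL : in_Rmax L).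
Local Notation A := (maxplus_mul U L).
Local Notation C := (maxplus_mul L U).
Hypothesis lambda0 : lambda A = 0%E.
Hypothesis G_critical : subgraph G (critical_graph A).
Let hA : in_Rmax A := in_Rmax_mul hU hL.

Fixpoint lift_wt (i : 'I_d) (p : seq 'I_d) (J : seq 'I_r) : \bar R :=
  match p, J with
  | y :: p', k :: J' => (U i k + L k y + lift_wt y p' J')%E
  | _, _ => 0%E
  end.

Lemma weight_interleave i p J : size J = size p ->
  weight (lift_mx U L)
    (interleave (map (@lshift d r) (i :: p)) (map (@rshift d r) J)) = lift_wt i p J.
Proof.
elim: p i J => [|y p IH] i [|k J] // => [_|[szJ]]; first by rewrite /weight big_nil.
rewrite -[interleave _ _]/(lshift r i :: rshift d k ::
  interleave (map (@lshift d r) (y :: p)) (map (@rshift d r) J)) [RHS]/= -(IH y J szJ).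
have [t ->] : exists t, interleave (map (@lshift d r) (y :: p))
    (map (@rshift d r) J) = lshift r y :: t by case: (J) => [|k' J']; eexists.
by rewrite /weight /warcs /= !big_cons /= block_mxEur block_mxEdl addeA.
Qed.

(** Each pair of half arcs weighs at most its arc of [A]. If the totals agree, all pairs are
    optimal, so every entry of [J] lifts an arc of [G]. *)
Lemma lift_wt_arcs i p J : size J = size p -> path (arc_rel G) i p ->
  (lift_wt i p J <= (wt (wtr A) i p)%:E)%E /\
  (((wt (wtr A) i p)%:E <= lift_wt i p J)%E -> {in J, forall k, lift_node U L G k}).
Proof.
elim: p i J => [|y p IH] i [|k J] //=.
case=> szJ /andP[iy py]; have [le arcs_] := IH y J szJ py.
have fiy : finr A i y := subgraph_sub hU hL lambda0 G_critical iy.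
case: (boolP (finr U i k && finr L k y)) => [/andP[fU fL]|nf]; last first.
  have -> : (U i k + L k y = -oo)%E.
    by apply/eqP; rewrite adde_eq_ninfty; move: nf; rewrite negb_and !negbK.
  by rewrite addNye leNye; split=> //; rewrite leeNy_eq.
have [_ leA] := finr_mul hU hL fU fL.
rewrite (wtrK hU fU) (wtrK hL fL); move: le arcs_; case: (lift_wt y p J) => [s| |].
- rewrite -!EFinD !lee_fin => le arcs_; split=> [|ge]; first by lra.
  move=> j; rewrite inE => /predU1P[->|]; last by apply: arcs_; lra.
  apply/lift_nodeP; exists i, y; rewrite /lifts iy fU fL /=.
  by apply/eqP/le_anti/andP; split; lra.
- by rewrite leye_eq => /eqP.
- by move=> _ _; rewrite addeNy; split; rewrite ?leNye ?leeNy_eq.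
Qed.

Lemma related_graph_sub :
  {subset nodes (related_graph U L G) <= lift_node U L G} /\
  subrel (arc_rel (related_graph U L G)) (finr C).
Proof.
split=> [k|k k'].
  rewrite inE => /asboolP[V [W]].
  case: W => [//|i p]; rewrite {1}/is_walk => /andP[iG pG] [].
  case/andP=> wW _ /andP[wV clV] /andP[n0 /eqP szV] _ [_ _ _].
  have szJ : size (take (wlen V) V) = size p.
    by rewrite size_take /wlen szV /= ltnSn.
  rewrite weight_interleave // => wE kV.
  have pA : path (finr A) i p.
    by apply: sub_path pG; apply: subgraph_sub.
  have [_] := lift_wt_arcs szJ pG; rewrite wE weightE // lexx => /(_ isT); apply.
  (* The lift omits the last entry of [V]; as [V] is closed with at least one arc, that entry is
     also its first one. *)
  move: V szV clV kV {wV wE szJ} => [//|v q] /= [szq] /eqP lq.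
  rewrite /wlen /=; move: n0; rewrite /wlen /= -szq.
  case/lastP: q lq {szq} => [//|q z]; rewrite last_rcons => ->.
  rewrite size_rcons /= -cats1 take_size_cat // !inE mem_cat inE.
  by case: (k == v); rewrite ?orbF.
rewrite /arc_rel inE => /asboolP[V [W _ [_ /andP[wV _] _ _ _]] kk'].
case: V wV kk' => [//|v q] /andP[_ pq] /warcs_split[p1 [p2 [qE l1]]].
by move: pq; rewrite qE cat_path l1 /= => /and3P[_]; rewrite inE.
Qed.

(** A cycle of length [gam * t] visits class [c] at [t] distinct nodes, all of them lifted. *)
Lemma circumference_class gam cl c : class_function (finr C) gam cl -> c < gam ->
  circumference (related_graph U L G) <=
    gam * #|[predI [pred k | cl k == c] & lift_node U L G]|.
Proof.
move=> cl_fun cg; have [sub_n sub_a] := related_graph_sub; have [cl_lt _] := cl_fun.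
apply/bigmax_leqP => n; rewrite inE => /asboolP[V /and4P[wV n0 clV uV] <-].
case: V wV n0 clV uV => [//|v [//|k q]] /andP[vG pV] _ /eqP lq uV.
have pG : path (arc_rel (related_graph U L G)) v (k :: q) by [].
have pC : path (finr C) v (k :: q) := sub_path sub_a pG.
have dvd : gam %| size (k :: q).
  have /eqP := class_last cl_fun pC; rewrite lq /= -{1}[cl v](modn_small (cl_lt v)).
  by rewrite -{1}[cl v]addn0 eqn_modDl mod0n eq_sym.
have pC' : path (finr C) k q by case/andP: pC.
have := class_visits cl_fun pC' cg; rewrite /wlen [size _]/=.
set cnt := count _ _ => le.
have le' : cnt <= #|[predI [pred k | cl k == c] & lift_node U L G]|.
  rewrite /cnt -size_filter -(card_uniqP (filter_uniq _ uV)).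
  apply: subset_leq_card; apply/subsetP => j; rewrite mem_filter !inE => /andP[-> jV] /=.
  apply: sub_n; have h : {in k :: q, forall j, j \in nodes (related_graph U L G)}.
    by apply: path_target pG => y z /arcs_nodes/andP[].
  exact: h.
apply: leq_trans (leq_mul (leqnn gam) le').
case/dvdnP: dvd => t; rewrite [size _]/= => tE; rewrite tE in le.
apply: (@leq_trans (t * gam)); first by rewrite -tE.
have : t < cnt.+1 by rewrite -(ltn_pmul2l (leq_ltn_trans (leq0n _) cg)) mulnS; lia_arith.
by rewrite ltnS mulnC leq_pmul2l // (leq_ltn_trans (leq0n _) cg).
Qed.

End RelatedGraph.

(** * Lifts of critical cycles *)

Section CriticalCycles.
Variables (R : realType) (d r : nat).
Variables (U : 'M[\bar R]_(d, r)) (L : 'M[\bar R]_(r, d)).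
Hypotheses (hU : in_Rmax U) (hL : in_Rmax L).
Local Notation A := (maxplus_mul U L).
Local Notation C := (maxplus_mul L U).
Hypothesis lambda0 : lambda A = 0%E.
Let hA : in_Rmax A := in_Rmax_mul hU hL.

Lemma reach_trans (T : finType) (H : digraph T) x y z :
  reach H x y -> reach H y z -> reach H x z.
Proof.
case=> [[//|x1 p]] /andP[/andP[xH px] /andP[/eqP xx1 /eqP lp]].
case=> [[//|y1 q]] /andP[/andP[_ qy] /andP[/eqP yy1 /eqP lq]]; subst x1 y1.
exists (x :: p ++ q); rewrite /walk_between /= xH cat_path last_cat px lp qy lq.
by rewrite !eqxx.
Qed.

Lemma arc_rel_reach (G : digraph 'I_d) i p : path (arc_rel G) i p ->
  p != [::] -> reach G i (last i p).
Proof.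
case: p => [//|y p] py _; exists (i :: y :: p).
apply: arc_rel_walk; last exact: walk_path.
by move: py => /= /andP[/arc_rel_nodes[]].
Qed.

Lemma zero_closed_reach i p x y : walk (finr A) i i p -> (0 <= wt (wtr A) i p)%R ->
  p != [::] -> x \in i :: p -> y \in i :: p -> reach (critical_graph A) x y.
Proof.
move=> wp h np.
have from_i z : z \in i :: p -> reach (critical_graph A) i z /\ reach (critical_graph A) z i.
  move=> zp; have pc := critical_arcs hA lambda0 wp h.
  have ii : reach (critical_graph A) i i.
    by have := arc_rel_reach pc np; rewrite (walk_last wp).
  have [p1 [p2 [pE l1]]] := split_at zp; have := walk_last wp.
  move: pc; rewrite pE cat_path last_cat l1 => /andP[pc1 pc2] l2; split.
    case: (eqVneq p1 [::]) => [p10|np1]; first by rewrite -l1 p10.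
    by rewrite -l1; apply: arc_rel_reach.
  case: (eqVneq p2 [::]) => [p20|np2]; first by move: l2; rewrite p20 /= => ->.
  by rewrite -l2; apply: arc_rel_reach.
by move=> /from_i[_ h1] /from_i[h2 _]; apply: reach_trans h1 h2.
Qed.

Lemma bigmin_le (I : eqType) (s : seq I) (P : pred I) (F : I -> nat) N k :
  k \in s -> P k -> \big[minn/N]_(i <- s | P i) F i <= F k.
Proof.
elim: s => [//|x s IH]; rewrite inE big_cons => /predU1P[<- ->|ks Pk].
  exact: geq_minl.
by have := IH ks Pk; case: (P x) => // le; rewrite geq_min le orbT.
Qed.

(** All arcs of such a closed walk are critical, so a simple loop inside it is a cycle of the
    component. *)
Lemma girth_component_le x y p : walk (finr A) y y p -> (0 <= wt (wtr A) y p)%R ->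
  p != [::] -> reach (critical_graph A) x y -> reach (critical_graph A) y x ->
  girth (component (critical_graph A) x) <= size p.
Proof.
move=> wp h np xy yx; have pc := critical_arcs hA lambda0 wp h.
have lp := walk_last wp.
have /simple_loop_exists[p1 [p2 [p3 [pE n2 l2 u2]]]] : ~~ uniq (y :: p).
  by rewrite /= -{1}lp; case: (p) np => // z s _; rewrite /= mem_last.
have comp z : z \in y :: p -> z \in nodes (component (critical_graph A) x).
  move=> zp; rewrite inE; apply/andP; split; apply/asboolP.
    by apply: reach_trans xy _; apply: (zero_closed_reach wp h np _ zp); rewrite mem_head.
  by apply: reach_trans yx; apply: (zero_closed_reach wp h np zp); rewrite mem_head.
set z := last y p1 in l2.
have le2 : size p2 <= size p by rewrite pE !size_cat; lia_arith.
apply: leq_trans le2.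
have sz2 : size p2 < #|'I_d|.+1 by rewrite ltnS -(card_uniqP u2) max_card.
apply: (@bigmin_le _ _ _ _ _ (Ordinal sz2)); first by rewrite mem_index_enum.
rewrite inE; apply/asboolP; exists (z :: p2) => //.
set K := component _ _ in comp *.
have sub2 : {subset z :: p2 <= y :: p}.
  move=> v; rewrite pE inE => /predU1P[->|v2]; first by rewrite -cat_cons mem_cat mem_last.
  by rewrite inE !mem_cat v2 !orbT.
have cpath : path (arc_rel K) z p2.
  move: pc; rewrite pE !cat_path -/z => /and3P[_ pc2 _].
  apply: (@sub_in_path _ [in nodes K] (arc_rel (critical_graph A))) pc2.
    by move=> a b aK bK ab; rewrite /arc_rel inE; apply/and3P; split.
  by apply/allP => v /sub2/comp.
apply/and4P; split=> //; first by apply/andP; split; [apply/comp/sub2/mem_head | ].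
  by rewrite /wlen lt0n size_eq0.
by rewrite /is_closed l2.
Qed.

Section FixedCycle.
Variables (i0 : 'I_d) (p : seq 'I_d).
Hypothesis Z_critical : is_critical A (i0 :: p).
Local Notation Z := (graph_of_walk (i0 :: p)).

Lemma critical_loop : [/\ walk (finr A) i0 i0 p, uniq p, p != [::] & wt (wtr A) i0 p = 0%R].
Proof. exact/(is_critical_loop hA lambda0). Qed.

Lemma nodes_graph_of_walk x : (x \in nodes Z) = (x \in i0 :: p).
Proof.
apply/idP/idP; first by rewrite inE => /asboolP[W ->].
by move=> xp; rewrite inE; apply/asboolP; exists (i0 :: p).
Qed.

Lemma graph_of_walk_arc x y : (x, y) \in warcs (i0 :: p) -> arc_rel Z x y.
Proof. by move=> xy; rewrite /arc_rel inE; apply/asboolP; exists (i0 :: p). Qed.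

Lemma graph_of_walk_loop : walk (arc_rel Z) i0 i0 p.
Proof.
have [wp _ _ _] := critical_loop.
rewrite /walk (walk_last wp) eqxx andbT.
have : forall p1 y p2, p = p1 ++ y :: p2 -> arc_rel Z (last i0 p1) y.
  by move=> p1 y p2 pE; apply: graph_of_walk_arc; rewrite pE mem_warcs_mid.
move: (arc_rel Z) => e; elim: (p) (i0) => [//|y q IH] i arc /=.
rewrite (arc [::] y q erefl) /=.
by apply: IH => p1 z p2 qE; apply: (arc (y :: p1) z p2); rewrite qE.
Qed.

Lemma graph_of_walk_critical : subgraph Z (critical_graph A).
Proof.
apply/andP; split; apply/subsetP => x; rewrite !inE => /asboolP[W -> xW];
  by apply/asboolP; exists (i0 :: p).
Qed.

Lemma graph_of_walk_connected : strongly_connected Z.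
Proof.
move=> x y; rewrite !nodes_graph_of_walk => xp yp.
have [q [wq szq sub _]] := walk_rot R graph_of_walk_loop xp.
have np : p != [::] by case: critical_loop.
have ip : i0 \in p.
  rewrite -{1}(walk_last graph_of_walk_loop).
  by case: (p) np => //= z s _; apply: mem_last.
have yq : y \in x :: q by rewrite inE sub ?orbT //; move: yp; rewrite inE => /predU1P[->|].
have [q1 [q2 [qE l1]]] := split_at yq.
exists (x :: q1); apply: arc_rel_walk; first by rewrite nodes_graph_of_walk.
by move: wq; rewrite qE walk_catE l1 => /andP[].
Qed.

Lemma graph_of_walk_arcs : arcs Z != set0.
Proof.
have [_ _ np _] := critical_loop; apply/set0Pn.
case: (p) np (graph_of_walk_loop) => // y q _; rewrite /walk /= => /andP[/andP[h _] _].
by exists (i0, y).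
Qed.

Local Notation g := (lift_arc U L Z).
Let lift_max :=
  lift_walk_max hU hL lambda0 graph_of_walk_critical graph_of_walk_connected.
Let lift_sub :=
  lift_arc_sub hU hL lambda0 graph_of_walk_critical graph_of_walk_connected.
Let lift_mid :=
  lift_arc_mid hU hL lambda0 graph_of_walk_critical graph_of_walk_connected.

(** Compared with the empty walk, a loop of lifted arcs has nonnegative weight. It is opened at the
    middle node of its first arc, which lies on the critical cycle, and regrouped on [A]. *)
Lemma lift_loop_lower k q : walk g k k q -> q != [::] -> exists y p',
  [/\ y \in i0 :: p, walk (finr A) y y p', size p' = size q & (0 <= wt (wtr A) y p')%R].
Proof.
move=> wq nq; have := lift_max wq (q := [::]); rewrite walk_nil => /(_ (eqxx _)).
have wC := sub_walk lift_sub wq.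
case: q wq nq wC => [//|k' q]; rewrite /walk /= -andbA.
move=> /andP[kk' _] _ /andP[/andP[_ pq] /eqP lq].
have [y [yZ fky fyk' wE]] := lift_mid kk'.
have [|p' [wp' szp' le]] := path_transfer (j := y) hU hL fyk' pq; first by rewrite lq.
rewrite lq in le => ge; exists y, p'; split=> //; first by rewrite -nodes_graph_of_walk.
by rewrite wE in ge; lra.
Qed.

Lemma lift_cycle_exists : exists k q, walk g k k q /\ size q = size p.
Proof.
have [_ _ np _] := critical_loop.
have [y [s pE]] : exists y s, p = y :: s by case: (p) np => // y s _; exists y, s.
have wZ : walk (arc_rel Z) i0 i0 (y :: s) by rewrite -pE; apply: graph_of_walk_loop.
move: wZ; rewrite /walk /= -andbA => /andP[iy ws].
have [k h] := lift_exists hU hL lambda0 graph_of_walk_critical iy.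
have [q wq sq] := lift_chain hU hL lambda0 graph_of_walk_critical h ws h.
by exists k, q; split=> //; rewrite sq pE.
Qed.

(** A repeated node in the lift of the cycle would split off a shorter loop of lifted arcs, hence a
    shorter nonnegative closed walk on [A] at a node of the cycle, against the last hypothesis. So
    the lift is a cycle with [gam * m] distinct nodes. *)
Lemma critical_cycle_bound gam m cl :
  0 < gam -> 0 < m -> size p = gam * m -> r < gam * m.+1 ->
  class_function (finr C) gam cl ->
  (forall y p', y \in i0 :: p -> walk (finr A) y y p' -> p' != [::] ->
     (0 <= wt (wtr A) y p')%R -> size p <= size p') ->
  exists2 T, is_Twr A Z (gam * m) T & T <= gam * Wi m + r + gam.
Proof.
move=> g0 m0 szp rlt cl_fun short.
have [k [q [wq szq]]] := lift_cycle_exists.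
have [qn pn] : q != [::] /\ p != [::].
  by split; rewrite -size_eq0 ?szq szp muln_eq0; lia_arith.
have uq : uniq q.
  case: (boolP (uniq q)) => // nu; case: q wq szq qn nu => // a q wq szq _ nu.
  have [p1 [p2 [p3 [qE n2 l2 u2]]]] := simple_loop_exists nu.
  move: wq; rewrite /walk /= -andbA => /and3P[_ pq _].
  have := walk_path pq; rewrite {2}qE !walk_catE l2 => /and3P[_ w2 _].
  have [y [p' [yZ wp' szp' ge]]] := lift_loop_lower w2 n2.
  have n' : p' != [::] by rewrite -size_eq0 szp' size_eq0.
  have := short y p' yZ wp' n' ge.
  by rewrite szp' -szq qE /= !size_cat; lia_arith.
have cq : cycle g q.
  case/lastP: q wq {szq qn uq} => // s z; rewrite /walk last_rcons => /andP[ps /eqP zk].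
  by subst z; rewrite -(rot_cycle (size s)) -cats1 rot_size_cat.
apply: (Twr_bound hU hL lambda0 graph_of_walk_critical graph_of_walk_connected).
- by rewrite muln_gt0 g0.
- exact: graph_of_walk_arcs.
move=> k' s ps _ sz.
have := @cycle_reduction R _ (wtr C) (finr C) g gam m q g0 m0 (etrans szq szp) _ _
  lift_sub _ cq uq cl k' s cl_fun ps sz.
by rewrite card_ord; apply => //; exact: closed_walk_dual_le0.
Qed.

End FixedCycle.
End CriticalCycles.

(** * The bounds *)

(** The given cycle is not assumed to lie in a component of girth [r]. Where girth [r] is attained,
    the lift of a critical cycle contains a simple loop with at least [r] nodes, hence all indices.
    Some index thus lifts an arc of each of the two cycles, and their components coincide. *)
Lemma full_girth_component (R : realType) (d r : nat) (U : 'M[\bar R]_(d, r))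
    (L : 'M[\bar R]_(r, d)) i0 p : in_Rmax U -> in_Rmax L ->
  lambda (maxplus_mul U L) = 0%E ->
  max_girth (critical_graph (maxplus_mul U L)) = r ->
  is_critical (maxplus_mul U L) (i0 :: p) -> size p = r ->
  exists2 x, girth (component (critical_graph (maxplus_mul U L)) x) = r &
    forall y, y \in i0 :: p -> reach (critical_graph (maxplus_mul U L)) x y /\
      reach (critical_graph (maxplus_mul U L)) y x.
Proof.
move=> hU hL lam; set A := maxplus_mul U L => girthE critZ szp.
have hA : in_Rmax A := in_Rmax_mul hU hL.
have [wp _ np wtp] := critical_loop hU hL lam critZ.
have i0N : i0 \in nodes (critical_graph A).
  by rewrite inE; apply/asboolP; exists (i0 :: p); rewrite ?mem_head.
have cardN : 0 < #|nodes (critical_graph A)| by apply/card_gt0P; exists i0.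
have [x xN gx] := eq_bigmax_cond (fun x => girth (component (critical_graph A) x)) cardN.
rewrite -/(max_girth _) girthE in gx.
exists x; first by rewrite gx.
move: xN; rewrite inE => /asboolP[[|j0 s] critc xc]; first by case: critc.
have [ws _ ns wts] := critical_loop hU hL lam critc.
have x_s y : y \in j0 :: s -> reach (critical_graph A) x y /\ reach (critical_graph A) y x.
  by move=> ys; split; apply: (zero_closed_reach hU hL lam ws _ ns); rewrite ?wts.
have p_y y y' : y \in i0 :: p -> y' \in i0 :: p -> reach (critical_graph A) y y'.
  by move=> yp yp'; apply: (zero_closed_reach hU hL lam wp _ np); rewrite ?wtp.
set G' := graph_of_walk (j0 :: s).
have subG' := graph_of_walk_critical critc.
have conG' := graph_of_walk_connected hU hL lam critc.
have full k : lift_node U L G' k.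
  have [k0 [q [wq szq]]] := lift_cycle_exists hU hL lam critc.
  have nq : q != [::] by rewrite -size_eq0 szq size_eq0.
  have lq := walk_last wq.
  have /simple_loop_exists[q1 [q2 [q3 [qE n2 l2 u2]]]] : ~~ uniq (k0 :: q).
    by rewrite /= -{1}lq; case: (q) nq => // z t _; rewrite /= mem_last.
  move: wq; rewrite qE !walk_catE l2 => /and3P[_ w2 _].
  have [y [p' [ys wp' szp' ge]]] := lift_loop_lower hU hL lam critc w2 n2.
  have n' : p' != [::] by rewrite -size_eq0 szp' size_eq0.
  have [xy yx] := x_s y ys.
  have := girth_component_le hU hL lam wp' ge n' xy yx; rewrite -gx szp' => le.
  have kq : k \in q2.
    have sub : {subset q2 <= enum 'I_r} by move=> z _; rewrite mem_enum.
    have [|_ ->] := uniq_min_size u2 sub; last by rewrite mem_enum.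
    by rewrite -cardE card_ord.
  have h : {in q2, forall z, lift_node U L G' z}.
    apply: (path_target (e := lift_arc U L G')) (proj1 (andP w2)).
    by move=> z z' /lift_arc_nodes[].
  exact: h.
have [y0 [p0 pE]] : exists y0 p0, p = y0 :: p0 by case: (p) np => // y0 p0 _; exists y0, p0.
have wZ : walk (arc_rel (graph_of_walk (i0 :: p))) i0 i0 (y0 :: p0).
  by have := graph_of_walk_loop hU hL lam critZ; rewrite [X in walk _ _ _ X]pE.
move: wZ; rewrite /walk /= -andbA => /andP[iy _].
have [k /and4P[_ fU fL /eqP wE]] :=
  lift_exists hU hL lam (graph_of_walk_critical critZ) iy.
have /lift_nodeP[x2 [y2 /and4P[xy2 fU2 fL2 /eqP wE2]]] := full k.
(* Exchanging the two arcs lifting through [k] merges the critical cycles. *)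
have [x2s y2s] : x2 \in j0 :: s /\ y2 \in j0 :: s.
  by rewrite -!nodes_graph_of_walk; apply: arc_rel_nodes.
have [s' ws'] : exists s', walk (arc_rel G') y2 x2 s'.
  by apply: (subgraph_connect conG'); rewrite nodes_graph_of_walk.
have ge_s : (0 <= wt (wtr A) x2 (y2 :: s'))%R.
  apply: (subgraph_closed_ge0 hU hL lam subG').
  by move: ws'; rewrite /walk /= -/(arc_rel G' x2 y2) xy2.
have wsA : walk (finr A) y2 x2 s' := sub_walk (subgraph_sub hU hL lam subG') ws'.
have wpA : walk (finr A) y0 i0 p0 by move: wp; rewrite pE /walk /= => /andP[/andP[_ ->] ->].
have [f1 le1] := finr_mul hU hL fU fL2.
have [f2 le2] := finr_mul hU hL fU2 fL.
have wall : walk (finr A) i0 i0 ((y2 :: s') ++ y0 :: p0).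
  apply: (@walk_cat _ _ _ x2).
    by move: wsA; rewrite /walk /= => /andP[-> ->]; rewrite andbT; apply/andP.
  by move: wpA; rewrite /walk /= => /andP[-> ->]; rewrite andbT; apply/andP.
have ge_all : (0 <= wt (wtr A) i0 ((y2 :: s') ++ y0 :: p0))%R.
  rewrite wt_cat /= (walk_last wsA); move: wtp ge_s; rewrite pE /= wE wE2; lra.
have reach_all := zero_closed_reach hU hL lam wall ge_all isT.
have y2all : y2 \in i0 :: (y2 :: s') ++ y0 :: p0 by rewrite !inE eqxx orbT.
have i0all : i0 \in i0 :: (y2 :: s') ++ y0 :: p0 by rewrite inE eqxx.
have [xy yx] := x_s y2 y2s.
move=> y yp; split.
  apply: reach_trans xy (reach_trans (reach_all _ _ y2all i0all) _).
  by apply: p_y; rewrite ?mem_head.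
apply: reach_trans (reach_trans _ (reach_all _ _ i0all y2all)) yx.
by apply: p_y; rewrite ?mem_head.
Qed.

(** Visits are counted in a class with at most [m] nodes, if possible one without [k]. If all other
    classes have at least [m + 1] nodes, the class of [k] is left with at most [m]. *)
Lemma class_count_bound (T : finType) (e : rel T) (S : pred T) gam l cl a q k cr :
  0 < gam -> gam %| l -> 0 < l -> class_function e gam cl -> path e a q ->
  (forall x, count_mem x (a :: q) <= l %/ gam + (if S x then x == k else true)) ->
  (forall c, c < gam -> cr <= gam * #|[predI [pred x | cl x == c] & S]|) ->
  (size q).+1 <= l * (#|T| %/ gam) + #|T| - cr + gam.
Proof.
move=> g0 gl l0 cl_fun pq cnt crP; have [cl_lt _] := cl_fun.
set m := #|T| %/ gam; pose h c := #|[pred x | cl x == c]|.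
have mT : gam * m <= #|T| by rewrite mulnC leq_trunc_div.
have mT' : #|T| < gam * m.+1 by rewrite mulnC ltn_ceil.
have bound c : c < gam ->
    (size q).+1 + cr <= h c * l + gam * h c + gam * (cl k == c) + (gam - 1).
  move=> cg; have := count_visits_le [pred x | cl x == c] cnt.
  have := class_visits cl_fun pq cg; have := crP c cg; rewrite /= -/(h c).
  set v := _ + count _ _; set s := #|_| => h1 h2 h3.
  have lE : gam * (l %/ gam) = l by rewrite mulnC divnK.
  have : gam * (v + s) <= h c * l + gam * h c + gam * (cl k == c).
    rewrite -{1}lE mulnCA -!mulnDr leq_mul2l; apply/orP; right.
    by apply: leq_trans h3 _; rewrite leqnn.
  rewrite mulnDr; lia_arith.
have [[c [cg ck hc]]|none] := pselect (exists c, [/\ c < gam, c != cl k & h c <= m]).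
  have := bound c cg; rewrite eq_sym (negPf ck) muln0 addn0.
  have := leq_mul hc (leqnn l); have := leq_mul (leqnn gam) hc.
  by rewrite [l * m]mulnC; lia_arith.
have hk : h (cl k) + (gam - 1) * m.+1 <= #|T|.
  rewrite -(sum_class_card cl_lt) (bigD1 (Ordinal (cl_lt k))) //= leq_add2l.
  rewrite subn1 -[gam in gam.-1]card_ord -(cardC1 (Ordinal (cl_lt k))) -sum_nat_const.
  apply: leq_sum => c ck; rewrite ltnNge; apply/negP => hc; apply: none.
  by exists c; split=> //; apply: contra ck => /eqP h'; apply/eqP/val_inj.
have := bound (cl k) (cl_lt k); rewrite eqxx muln1.
have gm : gam * m.+1 = (gam - 1) * m.+1 + m.+1.
  by rewrite -{1}(subnK g0) mulnDl mul1n.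
have gm' : (gam - 1) * m.+1 + m = gam * m + (gam - 1).
  by have := mulnS gam m; lia_arith.
(* With [m] nodes in this class, [#|T|] is at least [gam * m + gam - 1], which absorbs the extra
   [gam] due to [k]; with fewer, the missing node compensates for it. *)
have [hm|hm] := leqP m (h (cl k)).
  have -> : h (cl k) = m by lia_arith.
  by rewrite [l * m]mulnC; lia_arith.
have := leq_mul hm (leqnn l); have := leq_mul (leqnn gam) hm.
by rewrite mulSn mulnS [l * m]mulnC; lia_arith.
Qed.

Theorem proposition4p12 (R : realType) (d r : nat)
    (A : 'M[\bar R]_d) (U : 'M[\bar R]_(d, r)) (L : 'M[\bar R]_(r, d))
    (G : digraph 'I_d)
    (hA : in_Rmax A) (hU : in_Rmax U) (hL : in_Rmax L)
    (hlam : lambda A = 0%E)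
    (hr : is_factor_rank A r)
    (hUL : A = maxplus_mul U L)
    (hGc : subgraph G (critical_graph A))
    (hGsc : strongly_connected G)
    (hGarc : arcs G != set0) :
  [/\ forall l : nat, 0 < l ->
        exists2 T : nat, is_Twr A G l T &
          T <= 1 + r * (l + 1) - #|nodes (related_graph U L G)|,
      forall gamma l : nat,
        irreducible A -> gamma = cyclicity (mxgraph A) ->
        0 < l -> gamma %| l ->
        exists2 T : nat, is_Twr A G l T &
          T <= l * (r %/ gamma) + r - circumference (related_graph U L G)
               + gamma,
      forall Z : seq 'I_d,
        max_girth (critical_graph A) = r ->
        is_critical A Z -> wlen Z = r ->
        exists2 T : nat, is_Twr A (graph_of_walk Z) r T &
          T <= Wi r + r + 1 &
      forall (gamma : nat) (Z : seq 'I_d) (x : 'I_d),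
        irreducible A -> gamma = cyclicity (mxgraph A) ->
        max_girth (critical_graph A) = gamma * (r %/ gamma) ->
        is_critical A Z -> wlen Z = gamma * (r %/ gamma) ->
        is_cycle (component (critical_graph A) x) Z ->
        girth (component (critical_graph A) x) = wlen Z ->
        exists2 T : nat, is_Twr A (graph_of_walk Z) (gamma * (r %/ gamma)) T &
          T <= gamma * Wi (r %/ gamma) + r + gamma].
Proof.
subst A.
have alive := factor_rank_alive hU hL hr.
have trivial_class (e : rel 'I_r) : class_function e 1 (fun _ => 0) by split.
have class_dual : irreducible (maxplus_mul U L) ->
    exists cl, class_function (finr (maxplus_mul L U))
      (cyclicity (mxgraph (maxplus_mul U L))) cl.
  move=> irr; have [[u v] uv] := set0Pn _ hGarc.
  have [uG _] := arc_rel_nodes uv.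
  have [p wp np] := subgraph_loop hGsc uG hGarc.
  have [|clA clA_fun] := cyclicity_class_function irr; last exact: dual_class_function clA_fun.
  by exists u, p; split=> //; apply: sub_walk wp; apply: subgraph_sub.
have reduce gam l cl k q : 0 < l -> gam %| l ->
    class_function (finr (maxplus_mul L U)) gam cl ->
    path (finr (maxplus_mul L U)) k q -> has (lift_node U L G) (k :: q) ->
    exists q' z, [/\ walk (finr (maxplus_mul L U)) k (last k q) q',
      uses_arc (lift_arc U L G) k q',
      (wt (wtr (maxplus_mul L U)) k q <= wt (wtr (maxplus_mul L U)) k q')%R,
      size q' = size q %[mod l] &
      forall x, count_mem x (k :: q') <=
        l %/ gam + (if lift_node U L G x then x == z else true)].
  move=> l0 gl cl_fun pq Sq.
  apply: (walk_through_reduction cl_fun l0 gl) => //; last exact: walk_path.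
  - exact: closed_walk_dual_le0.
  - move=> x y xy; have [Sx Sy] := lift_arc_nodes xy; split=> //.
    by apply: lift_arc_sub xy.
  - by move=> x y p1 p2; apply: lift_walk_max.
  - by move=> x; apply: lift_loop.
have [sub_n _] := related_graph_sub hU hL hlam hGc.
split.
- move=> l l0; apply: (Twr_bound hU hL hlam hGc hGsc) => // k q pq Sq _.
  have [q' [z [wq' uq' le sz cnt]]] := reduce 1 l _ k q l0 (dvd1n l) (trivial_class _) pq Sq.
  exists q'; split=> //.
  set n := #|nodes _|; have := count_visits_le predT cnt.
  rewrite count_predT divn1 /= card_ord; have : n <= #|[predI predT & lift_node U L G]|.
    by apply: subset_leq_card; apply/subsetP => x /sub_n; rewrite inE.
  rewrite mulnDr muln1; move: (#|[predI _ & _]|) n (size q') (r * l) => s n k1 k2.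
  by lia_arith.
- move=> gamma l irr gE l0 gl; have [cl cl_fun] := class_dual irr; rewrite -gE in cl_fun.
  have g0 : 0 < gamma by apply: dvdn_gt0 gl.
  apply: (Twr_bound hU hL hlam hGc hGsc) => // k q pq Sq _.
  have [q' [z [wq' uq' le sz cnt]]] := reduce gamma l cl k q l0 gl cl_fun pq Sq.
  exists q'; split=> //; rewrite -{2 3}(card_ord r).
  apply: class_count_bound cnt _ => //; first exact: cl_fun.
    by case/andP: wq'.
  by move=> c; apply: circumference_class.
- case=> [|i0 p] girthE critZ; first by case: critZ.
  rewrite /wlen /= => szp.
  have r0 : 0 < r.
    by have [_ _ np _] := critical_loop hU hL hlam critZ; rewrite -szp lt0n size_eq0.
  have [x gx reachx] := full_girth_component hU hL hlam girthE critZ szp.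
  (* A single class with [m = r]: the lifted cycle passes through all indices. *)
  have := @critical_cycle_bound R d r U L hU hL hlam i0 p critZ 1 r (fun _ => 0).
  rewrite !mul1n; apply=> // y p' yp wp' np' ge.
  have [xy yx] := reachx y yp; rewrite szp -gx.
  exact: girth_component_le wp' ge np' xy yx.
- move=> gamma [|i0 p] x irr gE _ critZ; first by case: critZ.
  rewrite /wlen /= => szp cycZ gx.
  have [_ _ np _] := critical_loop hU hL hlam critZ.
  have : 0 < gamma * (r %/ gamma) by rewrite -szp lt0n size_eq0.
  rewrite muln_gt0 => /andP[g0 m0].
  have [cl cl_fun] := class_dual irr; rewrite -gE in cl_fun.
  apply: (critical_cycle_bound hU hL hlam critZ g0 m0 szp _ cl_fun).
    by rewrite mulnC ltn_ceil.
  move=> y p' yp wp' np' ge; rewrite -gx.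
  have yK : y \in nodes (component (critical_graph (maxplus_mul U L)) x).
    case/and4P: cycZ => /andP[iK pK] _ _ _; move: yp; rewrite inE => /predU1P[->//|].
    by apply: (path_target _ pK) => a b /arcs_nodes/andP[].
  move: yK; rewrite inE => /andP[/asboolP xy /asboolP yx].
  exact: girth_component_le wp' ge np' xy yx.
Qed.
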